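(* For every finite multiset $S$ of integers and every $d\ge 0$, \[ \mathsf{DS}^{*}(S,d;\mathbf{x})=\sum_P s_{\lambda(P)}(\mathbf{x}), \] where $P$ ranges over all Dyck tableaux with entries the multiset $S$ and $\mathrm{di}(\mathrm{RR}(P))=d$.
   Context: Sequences are finite integer sequences indexed from $0$, possibly empty; $|F|$ is the length of $F$. For $x=(x_0,\ldots,x_{m-1})$, $\mathrm{di}(x)=\#\{(i,j):0\le i<j<m,\ x_i=x_j+1\}$. A sequence $x$ is dual Dyck if $x_{i+1}\ge x_i+2$ for all $0\le i<m-1$. A factorization of $S$ is an ordered sequence $\mathcal F=(F_0,F_1,F_2,\ldots)$ of finite sequences, all but finitely many empty, such that the concatenation $F_0F_1F_2\cdots$ is a permutation (rearrangement) of the multiset $S$; it is a dual Dyck factorization if each $F_i$ is a dual Dyck sequence, and $\mathrm{di}(\mathcal F)=\mathrm{di}(F_0F_1F_2\cdots)$. Variables are $\mathbf{x}=(x_0,x_1,x_2,\ldots)$. The dual Dyck symmetric function is \[ \mathsf{DS}^{*}(S,d;\mathbf{x})=\sum_{\mathcal F}\ \prod_{r\ge0}x_r^{|F_r|}, \] the sum over dual Dyck factorizations $\mathcal F$ of $S$ with $\mathrm{di}(\mathcal F)=d$. A Dyck tableau is a left-aligned tableau with rows $T_0,T_1,\ldots,T_{\ell-1}$ from top to bottom (nonempty rows; the tableau with no rows is allowed), with $|T_0|\ge|T_1|\ge\cdots\ge|T_{\ell-1}|$, such that each row read left to right is a dual Dyck sequence, and whenever adjacent rows $T_j$ and $T_{j+1}$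 both have an entry in column $p$, $T_j[p]\le T_{j+1}[p]+1$. Its row-reading word is $\mathrm{RR}(P)=T_{\ell-1}T_{\ell-2}\cdots T_0$ (rows read left to right, bottom row first). Its shape $\lambda(P)$ is the partition of row lengths. $s_\lambda(\mathbf x)$ is the Schur function in the variables $x_0,x_1,x_2,\ldots$. *)

(* Defs.v *)
From mathcomp Require Import all_boot all_order all_algebra.
From mathcomp Require Export finmap multiset.
From mathcomp Require Export boolp classical_sets functions cardinality fsbigop.

Set Implicit Arguments.
Unset Strict Implicit.
Unset Printing Implicit Defensive.

Import GRing.Theory.

Local Open Scope mset_scope.
Local Open Scope fset_scope.
Local Open Scope classical_set_scope.
Local Open Scope ring_scope.

(* Formal power series in x_0, x_1, x_2, ... with integer coefficients, given
   by their coefficients.  A monomial is a multiset of variable indices: m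
   stands for the product of the x_r ^ (m r), with m r the multiplicity of r. *)
Definition fps := {mset nat} -> int.

Definition fps_monomial (m : {mset nat}) : fps := fun m' => (m' == m)%:R.

(* Coefficientwise sum of a possibly infinite family.  The finitely supported
   sum \sum_(i \in A) is 0 by convention on infinite support; in every use
   below only finitely many indices contribute to any given coefficient. *)
Definition fps_sum (I : choiceType) (A : set I) (f : I -> fps) : fps :=
  fun m => \sum_(i \in A) f i m.

Definition di (x : seq int) : nat :=
  #|[pred ij : 'I_(size x) * 'I_(size x) |
      (ij.1 < ij.2)%N && (x`_ij.1 == x`_ij.2 + 1)]|.

Definition dual_dyck (x : seq int) : bool := sorted (fun a b : int => a + 2 <= b) x.

Definition factors := {fsfun nat -> seq int with [::]}.

(* F_0 F_1 F_2 ..., cut after the last nonempty factor. *)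
Definition fconcat (F : factors) : seq int :=
  flatten (mkseq F (\max_(r <- finsupp F) r.+1)%N).

Definition dual_dyck_factorization (S : {mset int}) (F : factors) : Prop :=
  seq_mset (fconcat F) = S /\ forall r, dual_dyck (F r).

Definition factors_weight (F : factors) : {mset nat} :=
  [fsfun r in finsupp F => size (F r)].

Definition DS (S : {mset int}) (d : nat) : fps :=
  fps_sum [set F | dual_dyck_factorization S F /\ di (fconcat F) = d]
          (fun F => fps_monomial (factors_weight F)).

(* Left-aligned tableaux are lists of rows, top row first.  The relation r is
   required between any two vertically adjacent entries, upper one first. *)
Definition columns_rel (A : Type) (a0 : A) (r : rel A) (T : seq (seq A)) :=
  forall j p : nat,
    (p < size (nth [::] T j))%N -> (p < size (nth [::] T j.+1))%N ->
    r (nth a0 (nth [::] T j) p) (nth a0 (nth [::] T j.+1) p).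

Definition dyck_tableau (P : seq (seq int)) : Prop :=
  [/\ [::] \notin P, sorted geq (shape P), all dual_dyck P
    & columns_rel 0 (fun a b : int => a <= b + 1) P].

Definition row_reading (P : seq (seq int)) : seq int := flatten (rev P).

Definition semistandard (lam : seq nat) (T : seq (seq nat)) : Prop :=
  [/\ shape T = lam, all (sorted leq) T & columns_rel 0%N ltn T].

Definition schur (lam : seq nat) : fps :=
  fps_sum [set T | semistandard lam T]
          (fun T => fps_monomial (seq_mset (flatten T))).

(* Main.v *)
(* Gasharov's sign-reversing involution, in generating-function form. Let f be
   the generating function of the n-row arrays of dual Dyck rows with content S
   and di = d. Two adjacent rows split into maximal runs of consecutive
   integers lying in exactly one of the rows, alternately in each; exchanging
   the rows on the runs of odd length swaps the row sizes and preserves content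
   and di. Hence f is symmetric, so f a_delta = sum_w a_(|w| + delta), where a
   denotes alternants and delta = (n-1, ..., 0). Exchanging only the runs beyond
   the first violation of the tableau conditions transposes two exponents of
   the alternant, so the arrays that are not Dyck tableaux cancel. The
   bialternant formula turns each remaining a_(lambda + delta) into
   s_lambda a_delta, and a_delta can be cancelled. *)

Require Import Defs.
From mathcomp Require Import all_boot all_order all_fingroup all_algebra.
From mathcomp Require Import zify.

Set Implicit Arguments.
Unset Strict Implicit.
Unset Printing Implicit Defensive.

Import Order.TTheory GRing.Theory Num.Theory.

(** Within a run the occupied row alternates. In a run of odd length the steps from one row to the
    other and back are equally many, so an exchange keeps di, while it moves the single surplus
    entry to the other row. In a run of even length both rows have equally many entries, so leaving
    it alone already agrees with a swap of sizes. A cut must fall between runs. The identity has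
    infinitely many variables, so it is proved one coefficient m at a time, with n so large that m
    involves only the first n variables and no tableau has more than n rows. Integers are shifted to
    positions below M, and a row becomes a Boolean function, so that arrays form a finite type. The
    factor a_delta is not cancelled in several variables but in the domain Z[X], after a
    substitution that keeps the relevant monomials apart. The symmetry of f serves twice: in the
    product with a_delta, and because the factors are read F_0, F_1, ... while the reading word of
    an array starts with its last row. *)

Section OddRuns.
Variable d : nat -> bool.

Fixpoint run_length (v : nat) : nat :=
  if v is u.+1 then if d v then (run_length u).+1 else 0 else d 0.

Variable M : nat.

(** On a run, the position just after its end, so that [run_length] at the predecessor is the full
    length of the run. If the search fails, [find] returns [M], which is right when [d] vanishes
    from [M] on. *)
Definition run_end (v : nat) := find (fun u => (v <= u) && ~~ d u) (iota 0 M).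

Definition odd_run (v : nat) := d v && odd (run_length (run_end v).-1).

Lemma run_length0 v : ~~ d v -> run_length v = 0.
Proof. by case: v => [|v] /= /negbTE->. Qed.

Lemma run_lengthS v : d v.+1 -> run_length v.+1 = (run_length v).+1.
Proof. by move=> /= ->. Qed.

Lemma odd_run_next v : d v -> d v.+1 -> odd_run v = odd_run v.+1.
Proof.
move=> dv dv1; rewrite /odd_run dv dv1; congr (odd (run_length _.-1)).
apply: eq_find => u; rewrite ltn_neqAle.
by case: eqVneq => [<-|]; rewrite ?leqnn ?dv.
Qed.

Hypothesis dM : forall v, M <= v -> d v = false.

Lemma odd_run_last v : d v -> ~~ d v.+1 -> odd_run v = odd (run_length v).
Proof.
move=> dv dv1; rewrite /odd_run dv /=; suff -> : run_end v = v.+1 by [].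
have vM : v < M by rewrite ltnNge; apply/negP => /dM; rewrite dv.
rewrite /run_end -(subnKC vM) iotaD find_cat size_iota add0n.
rewrite ifN; last first.
  apply/hasPn => u; rewrite mem_iota /= add0n ltnS => uv.
  rewrite negb_and negbK -ltnNge; case: ltngtP uv => //= ->.
  by rewrite dv.
case: (M - v.+1) => [|k] /=; first by rewrite addn0.
by rewrite leqnSn dv1 addn0.
Qed.

End OddRuns.

(** Both invariants of the exchange are balanced over a run and not at each position. Writing the
    discrepancy as a difference of some [h] reduces them to a finite check at each position. *)
Lemma telescope_sum0 (M : nat) (h : nat -> int) :
  h 0%N = 0%R -> h M = 0%R -> (\sum_(v < M) (h v.+1 - h v) = 0)%R.
Proof.
move=> h0 hM; rewrite -(big_mkord xpredT (fun v => h v.+1 - h v)%R).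
by rewrite telescope_sumr // h0 hM subrr.
Qed.

(** * Exchanging two rows along their odd runs *)

Definition sparse (a : nat -> bool) := forall v, ~~ (a v && a v.+1).

Section TwoRows.
Variables (a b : nat -> bool) (M p : nat).
Hypotheses (sa : sparse a) (sb : sparse b).
Hypotheses (aM : forall v, M <= v -> a v = false)
           (bM : forall v, M <= v -> b v = false).
(** The position before [p] is outside every run, so the cut splits none; for [p = 0] the condition
    is void. *)
Hypothesis cut : forall u, u.+1 = p -> a u = b u.

Let d v := a v (+) b v.

(* d marks the positions of the runs: the pairs (a, a), and everything outside
   both rows, are never exchanged. *)
Definition flip v := (p <= v) && odd_run d M v.

Let a' v := if flip v then b v else a v.
Let b' v := if flip v then a v else b v.

Let dM v : M <= v -> d v = false.
Proof. by move=> Mv; rewrite /d aM ?bM. Qed.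

(** All that the later proofs see of runs: before the cut, off the runs, inside a run, and at the
    last position of a run, the only place where its parity is read off. *)
Lemma flip_cases v :
  [\/ v < p /\ flip v = false,
      d v = false /\ flip v = false,
      [/\ p <= v, d v, d v.+1 & flip v = flip v.+1]
    | [/\ p <= v, d v, d v.+1 = false & flip v = odd (run_length d v)]].
Proof.
rewrite /flip; case: (leqP p v) => [pv|]; last by constructor 1.
case dv: (d v); last by constructor 2; rewrite /odd_run dv.
case dv1: (d v.+1).
  by constructor 3; split; rewrite // (leqW pv) (odd_run_next M dv dv1).
by constructor 4; split; rewrite // (odd_run_last dM) ?dv1.
Qed.

(** At the cut itself a run can only begin, so its length so far is 0 or 1. *)
Lemma flip_run_start v : v < p -> odd (run_length d v.+1) = d v.+1 \/ v.+1 < p.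
Proof.
rewrite leq_eqVlt => /orP [/eqP /cut eab|]; last by right.
left; rewrite /= (@run_length0 d v) ?/d ?eab ?addbb //.
by case: (_ (+) _).
Qed.

(** Inside a run the new row copies one and the same old row. Where a run begins or ends, the
    neighbouring position outside it has equal entries in both rows, so the sparseness of the copied
    row still applies. *)
Lemma flip_sparse_l : sparse a'.
Proof.
move=> v; rewrite /a'; have := sa v; have := sb v.
case: (flip_cases v) => [[vp fv]|[dv fv]|[pv dv dv1 fv]|[pv dv dv1 fv]].
- rewrite fv; case: (ltnP v.+1 p) => [h|pv].
    by rewrite /flip leqNgt h.
  have /cut e : v.+1 = p by lia.
  by case: (flip v.+1); rewrite // e.
- by rewrite fv; move: dv; rewrite /d; case: (flip v.+1); case: (a v); case: (b v).
- by rewrite -fv; case: (flip v).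
- have -> : flip v.+1 = false by rewrite /flip /odd_run dv1 andbF.
  by move: dv1; rewrite /d; case: (flip v); case: (a v.+1); case: (b v.+1).
Qed.

(* Inside an exchanged run the change of the cross count is undone one step
   later, so it is the difference of a function h. *)
Lemma flip_cross :
  (\sum_(v < M) (a' v && b' v.+1) = \sum_(v < M) (a v && b v.+1))%N.
Proof.
apply/eqP; rewrite -eqz_nat -subr_eq0; apply/eqP.
pose h v : int := ((flip v && ~~ odd (run_length d v))%:R
   * ((a v)%:R - (b v)%:R))%R.
rewrite !(big_morph Posz PoszD (erefl _)) -sumrB -[RHS](@telescope_sum0 M h).
- apply: eq_bigr => [[v vM]] _ /=; rewrite /h /a' /b'.
  have := sa v; have := sb v.
  case: (flip_cases v) => [[vp fv]|[dv fv]|[pv dv dv1 fv]|[pv dv dv1 fv]].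
  + rewrite fv mul0r subr0; case: (flip_run_start vp) => [->|h1]; last first.
      by rewrite /flip leqNgt h1 /= subrr mul0r.
    have [dv1|] := boolP (d v.+1); last first.
      by rewrite /flip /odd_run => /negbTE ->; rewrite andbF subrr mul0r.
    rewrite andbF mul0r.
    have [h1|/cut e] : v.+1 < p \/ v.+1 = p by lia.
      by rewrite /flip leqNgt h1 subrr.
    rewrite e; move: dv1; rewrite /d.
    by case: (flip _); case: (b v); case: (a v.+1); case: (b v.+1).
  + rewrite fv mul0r subr0; have Lv : run_length d v = 0 by rewrite run_length0 ?dv.
    have [dv1|dv1] := boolP (d v.+1); last first.
      by rewrite /flip /odd_run (negbTE dv1) andbF subrr mul0r.
    rewrite run_lengthS // Lv andbF mul0r; move: dv dv1; rewrite /d.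
    by case: (flip _); case: (a v); case: (b v); case: (a v.+1); case: (b v.+1).
  + rewrite -fv run_lengthS //=; move: dv dv1; rewrite /d.
    case: (flip _); case: (odd _);
    by case: (a v); case: (b v); case: (a v.+1); case: (b v.+1).
  + have f1 : flip v.+1 = false by rewrite /flip /odd_run dv1 andbF.
    rewrite f1 fv andbN !mul0r; move: dv dv1; rewrite /d.
    case: (odd _);
    by case: (a v); case: (b v); case: (a v.+1); case: (b v.+1).
- rewrite /h /=; case e: (d 0); first by rewrite andbF mul0r.
  by rewrite /flip /odd_run e andbF mul0r.
- by rewrite /h /flip /odd_run dM // andbF mul0r.
Qed.

(** Exchanged runs turn [a] into [b]; the other runs have even length and alternate, so [a] and [b]
    have equally many entries there. [h v] is the excess accumulated before [v], nonzero only in the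
    middle of a pair of positions of such an even run. *)
Lemma flip_tail :
  (\sum_(v < M) ((p <= v) && a' v) = \sum_(v < M) ((p <= v) && b v))%N.
Proof.
apply/eqP; rewrite -eqz_nat -subr_eq0; apply/eqP.
pose h v : int := ([&& (p <= v)%N, d v, ~~ odd_run d M v & ~~ odd (run_length d v)]%:R
   * ((b v)%:R - (a v)%:R))%R.
rewrite !(big_morph Posz PoszD (erefl _)) -sumrB -[RHS](@telescope_sum0 M h).
- apply: eq_bigr => [[v vM]] _ /=; rewrite /h /a'.
  have := sa v; have := sb v.
  case: (flip_cases v) => [[vp fv]|[dv fv]|[pv dv dv1 fv]|[pv dv dv1 fv]].
  + rewrite leqNgt vp subrr mul0r subr0; case: (flip_run_start vp) => [->|h1].
      by case: (d v.+1); rewrite ?andbF mul0r.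
    by rewrite leqNgt h1 mul0r.
  + rewrite fv dv andbF mul0r subr0; have Lv : run_length d v = 0 by rewrite run_length0 ?dv.
    have [dv1|dv1] := boolP (d v.+1).
      rewrite run_lengthS // Lv !andbF mul0r; move: dv; rewrite /d.
      by case: (a v); case: (b v); rewrite ?subrr.
    rewrite andbF mul0r; move: dv; rewrite /d.
    by case: (a v); case: (b v); rewrite ?subrr.
  + move: fv; rewrite /flip pv (leqW pv) !andTb => <-.
    rewrite run_lengthS //=; move: dv dv1; rewrite /d.
    case: (odd_run _ _ _); case: (odd _);
    by case: (a v); case: (b v); case: (a v.+1); case: (b v.+1).
  + have := fv; rewrite /flip pv /= => ->.
    rewrite dv1 andbF mul0r dv; move: dv dv1; rewrite /d.
    by case: (odd _); case: (a v); case: (b v); case: (a v.+1); case: (b v.+1).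
- by rewrite /h /=; case: (d 0); rewrite ?andbF mul0r.
- by rewrite /h dM // andbF mul0r.
Qed.

End TwoRows.
Lemma eq_odd_run (d d' : nat -> bool) M : d =1 d' -> odd_run d M =1 odd_run d' M.
Proof.
move=> dd' v; rewrite /odd_run dd'; congr (_ && odd _).
have -> : run_end d M v = run_end d' M v by apply: eq_find => u; rewrite dd'.
by elim: (_.-1) => [|u IHu] /=; rewrite dd' ?IHu.
Qed.

(** An exchange does not affect where the rows differ. This makes the exchange an involution, and
    lets the facts on the upper row be reused for the lower one. *)
Lemma eq_flip (a b a' b' : nat -> bool) M p :
  (forall v, a v (+) b v = a' v (+) b' v) -> flip a b M p =1 flip a' b' M p.
Proof. by move=> dd' v; rewrite /flip (eq_odd_run _ dd'). Qed.

(** * Arrays of rows, and the exchange of two adjacent rows *)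

Section SumTwo.
Variables n j : nat.
Hypothesis jn : j.+1 < n.

Let off (k : nat) := (k != j) && (k != j.+1).

Lemma sum_two (e : nat -> nat) :
  \sum_(k < n) e k = e j + e j.+1 + \sum_(k < n | off k) e k.
Proof.
pose i1 := Ordinal (ltnW jn); pose i2 := Ordinal jn.
rewrite (bigD1 i1) //= (bigD1 i2) /=; last by rewrite -val_eqE /=; lia.
by rewrite addnA.
Qed.

(** Any other row lies on the same side of [j] and of [j.+1], so only its total count with the two
    rows matters; the pair of rows itself is treated apart. *)
Lemma crossings_two (C C' : nat -> nat -> nat) :
    C j j.+1 = C' j j.+1 ->
    (forall k, off k -> C k j + C k j.+1 = C' k j + C' k j.+1) ->
    (forall k, off k -> C j k + C j.+1 k = C' j k + C' j.+1 k) ->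
    (forall k l, off k -> off l -> C k l = C' k l) ->
  \sum_(l < n) \sum_(k < n) (k < l) * C k l
    = \sum_(l < n) \sum_(k < n) (k < l) * C' k l.
Proof.
move=> h1 h2 h3 h4.
have red (D : nat -> nat -> nat) :
  \sum_(l < n) \sum_(k < n) (k < l) * D k l = D j j.+1
   + (\sum_(k < n | off k) (k < j) * (D k j + D k j.+1)
   + \sum_(l < n | off l) ((j < l) * (D j l + D j.+1 l)
       + \sum_(k < n | off k) (k < l) * D k l)).
  have -> : \sum_(k < n | off k) (k < j) * (D k j + D k j.+1)
     = \sum_(k < n | off k) (k < j) * D k j
     + \sum_(k < n | off k) (k < j.+1) * D k j.+1.
    rewrite -big_split; apply: eq_bigr => k /andP [kj _].
    by rewrite mulnDr; congr (_ + _ * _); congr nat_of_bool; lia.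
  rewrite (sum_two (fun l => \sum_(k < n) (k < l) * D k l)).
  rewrite (sum_two (fun k => (k < j) * D k j)).
  rewrite (sum_two (fun k => (k < j.+1) * D k j.+1)).
  rewrite !ltnn ltnSn [j.+1 < j]ltnNge leqnSn.
  have -> : \sum_(l < n | off l) \sum_(k < n) (k < l) * D k l
     = \sum_(l < n | off l) ((j < l) * (D j l + D j.+1 l)
       + \sum_(k < n | off k) (k < l) * D k l); last by lia.
  apply: eq_bigr => l /andP [_ lj]; rewrite (sum_two (fun k => (k < l) * D k l)).
  by congr (_ + _); rewrite mulnDr; congr (_ + _ * _); congr nat_of_bool; lia.
rewrite !red h1; congr (_ + (_ + _)).
  by apply: eq_bigr => k ok; rewrite h2.
apply: eq_bigr => l ol; rewrite h3 //; congr (_ + _).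
by apply: eq_bigr => k ok; rewrite h4.
Qed.

End SumTwo.

Section Arrays.
Variables n M : nat.

(** The value at [(i, u)] tells whether row [i] contains position [u]. Arrays thus form a finite
    type, over which sums can be reindexed by involutions. *)
Definition array := {ffun 'I_n * 'I_M -> bool}.

Definition entry (w : array) (j v : nat) : bool :=
  if insub j is Some i then if insub v is Some u then w (i, u) else false
  else false.

Definition mk_array (f : nat -> nat -> bool) : array :=
  [ffun q : 'I_n * 'I_M => f q.1 q.2].

Implicit Types w : array.

Lemma entry_mk f j v : entry (mk_array f) j v = [&& j < n, v < M & f j v].
Proof.
rewrite /entry; case: insubP => [i -> iE|/negbTE -> //].
by case: insubP => [u -> uE|/negbTE -> //]; rewrite ffunE /= iE uE.
Qed.

Lemma entry_row w j v : n <= j -> entry w j v = false.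
Proof. by rewrite /entry leqNgt; case: insubP => [i ->|]. Qed.

Lemma entry_col w j v : M <= v -> entry w j v = false.
Proof.
by rewrite /entry leqNgt; case: insubP => // i _ _; case: insubP => [i' ->|].
Qed.

Lemma arrayP w w' :
  (forall j v, j < n -> v < M -> entry w j v = entry w' j v) -> w = w'.
Proof.
move=> e; apply/ffunP => [[i u]]; have := e i u (ltn_ord i) (ltn_ord u).
by rewrite /entry !valK.
Qed.

Definition row_size w j := \sum_(v < M) entry w j v.

(** For sparse rows this is [di] of the word that reads row [n.-1] first and row 0 last. *)
Definition crossings w :=
  \sum_(l < n) \sum_(k < n) (k < l) * \sum_(v < M) (entry w k v && entry w l v.+1).

Definition valid (mu : nat -> nat) (d : nat) w :=
  `[< [/\ forall j, sparse (entry w j),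
          forall v, \sum_(j < n) entry w j v = mu v & crossings w = d] >].

Definition swap (j k : nat) := if k == j then j.+1 else if k == j.+1 then j else k.

Lemma swapK j : involutive (swap j).
Proof.
move=> k; rewrite /swap; case: (eqVneq k j) => [->|kj].
  by rewrite gtn_eqF // eqxx.
by case: (eqVneq k j.+1) => [->|kj1]; rewrite ?eqxx // (negbTE kj) (negbTE kj1).
Qed.

Definition swap_tail (p j : nat) w :=
  mk_array (fun k v =>
    entry w (if flip (entry w j) (entry w j.+1) M p v then swap j k else k) v).

Section SwapTail.
Variables (p j : nat) (w : array).
Hypothesis jn : j.+1 < n.

Let A := entry w j.
Let B := entry w j.+1.
Let fl := flip A B M p.

Lemma entry_swap_tail k v :
  entry (swap_tail p j w) k v = entry w (if fl v then swap j k else k) v.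
Proof.
rewrite entry_mk; case: (ltnP v M) => [_|vM]; last by rewrite andbF entry_col.
case: (ltnP k n) => //= nk; rewrite entry_row // /swap.
by case: ifP => // _; case: eqP => [?|_]; [lia|case: eqP => [?|_] //; lia].
Qed.

Lemma swap_tail_top v :
  entry (swap_tail p j w) j v = if fl v then B v else A v.
Proof. by rewrite entry_swap_tail /swap eqxx; case: ifP. Qed.

Lemma swap_tail_bot v :
  entry (swap_tail p j w) j.+1 v = if fl v then A v else B v.
Proof. by rewrite entry_swap_tail /swap eqxx gtn_eqF //; case: ifP. Qed.

Lemma swap_tail_off k v : (k != j) && (k != j.+1) ->
  entry (swap_tail p j w) k v = entry w k v.
Proof.
by rewrite entry_swap_tail /swap => /andP [/negbTE-> /negbTE->]; case: ifP.
Qed.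

Lemma swap_tail_head k v : v < p -> entry (swap_tail p j w) k v = entry w k v.
Proof. by rewrite entry_swap_tail /fl /flip ltnNge => /negbTE ->. Qed.

Lemma swap_tail_sum v : entry (swap_tail p j w) j v
  + entry (swap_tail p j w) j.+1 v = A v + B v.
Proof. by rewrite swap_tail_top swap_tail_bot; case: ifP => //; rewrite addnC. Qed.

Lemma swap_tailK : swap_tail p j (swap_tail p j w) = w.
Proof.
apply: arrayP => k v kn vM; rewrite entry_mk kn vM /=.
rewrite (_ : flip _ _ M p v = fl v); last first.
  apply: eq_flip => u; rewrite swap_tail_top swap_tail_bot.
  by case: ifP => // _; rewrite addbC.
rewrite entry_swap_tail; case: (fl v) => //; congr (entry w _ v).
exact: swapK.
Qed.

Hypothesis cut : forall u, u.+1 = p -> A u = B u.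
Hypothesis sw : forall k, sparse (entry w k).

Let aM v : M <= v -> A v = false := @entry_col w j v.
Let bM v : M <= v -> B v = false := @entry_col w j.+1 v.
Let cutC u : u.+1 = p -> B u = A u.
Proof. by move=> /cut. Qed.
Let flC : flip B A M p =1 fl.
Proof. by apply: eq_flip => v; rewrite addbC. Qed.

Lemma swap_tail_sparse k : sparse (entry (swap_tail p j w) k).
Proof.
case: (eqVneq k j) => [->|kj].
  have := flip_sparse_l (sw j) (sw j.+1) aM bM cut.
  by move=> h v; rewrite !swap_tail_top.
case: (eqVneq k j.+1) => [->|kj1].
  have := flip_sparse_l (sw j.+1) (sw j) bM aM cutC.
  by move=> h v; have := h v; rewrite !flC !swap_tail_bot.
by move=> v; rewrite !swap_tail_off ?kj ?kj1 ?sw.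
Qed.

Lemma swap_tail_crossings : crossings (swap_tail p j w) = crossings w.
Proof.
rewrite /crossings.
pose C w' k l := \sum_(v < M) (entry w' k v && entry w' l v.+1).
apply: (@crossings_two n j jn (C (swap_tail p j w)) (C w)); rewrite /C.
- rewrite -(flip_cross (sw j) (sw j.+1) aM bM cut).
  by apply: eq_bigr => v _; rewrite swap_tail_top swap_tail_bot.
- move=> k ok; rewrite -!big_split; apply: eq_bigr => v _ /=.
  rewrite !(swap_tail_off _ ok) -!mulnb -!mulnDr swap_tail_sum.
  by rewrite mulnDr.
- move=> k ok; rewrite -!big_split; apply: eq_bigr => v _ /=.
  by rewrite !(swap_tail_off _ ok) -!mulnb -!mulnDl swap_tail_sum.
- by move=> k l ok ol; apply: eq_bigr => v _; rewrite !swap_tail_off.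
Qed.

Lemma swap_tail_content v :
  \sum_(k < n) entry (swap_tail p j w) k v = \sum_(k < n) entry w k v.
Proof.
rewrite !(sum_two jn (fun k => entry _ k v : nat)) swap_tail_sum.
by congr (_ + _); apply: eq_bigr => k ok; rewrite swap_tail_off.
Qed.

Lemma swap_tail_size_top :
  \sum_(v < M) ((p <= v) && entry (swap_tail p j w) j v)
  = \sum_(v < M) ((p <= v) && B v).
Proof.
rewrite -(flip_tail (sw j) (sw j.+1) aM bM cut).
by apply: eq_bigr => v _; rewrite swap_tail_top.
Qed.

Lemma swap_tail_size_bot :
  \sum_(v < M) ((p <= v) && entry (swap_tail p j w) j.+1 v)
  = \sum_(v < M) ((p <= v) && A v).
Proof.
rewrite -(flip_tail (sw j.+1) (sw j) bM aM cutC).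
by apply: eq_bigr => v _; rewrite swap_tail_bot flC.
Qed.

End SwapTail.

Lemma swap_tail_valid mu d p j w : j.+1 < n ->
  (forall u, u.+1 = p -> entry w j u = entry w j.+1 u) ->
  valid mu d w -> valid mu d (swap_tail p j w).
Proof.
move=> jn cut /asboolP [sw mw dw]; apply/asboolP; split.
- by move=> k; apply: swap_tail_sparse.
- by move=> v; rewrite swap_tail_content.
- by rewrite swap_tail_crossings.
Qed.

End Arrays.

(** * Alternants, and the symmetry of the generating function of arrays *)

Section Alternants.
Variables (R : comNzRingType) (n : nat) (x : nat -> R).

Local Open Scope ring_scope.

Definition alternant (e : nat -> nat) : R :=
  \det (\matrix_(i < n, j < n) x i ^+ e j).

Lemma eq_alternant e e' : (forall j, (j < n)%N -> e j = e' j) ->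
  alternant e = alternant e'.
Proof. by move=> ee; congr (\det _); apply/matrixP => i j; rewrite !mxE ee. Qed.

Lemma alternant_tperm (e e' : nat -> nat) (j1 j2 : 'I_n) : j1 != j2 ->
  (forall j : 'I_n, e' j = e (tperm j1 j2 j)) -> alternant e' = - alternant e.
Proof.
move=> j12 ee; rewrite /alternant.
have -> : \matrix_(i < n, j < n) x i ^+ e' j
    = col_perm (tperm j1 j2) (\matrix_(i < n, j < n) x i ^+ e j).
  by apply/matrixP => i j; rewrite !mxE ee.
by rewrite col_permE det_mulmx det_perm odd_permV odd_tperm j12 mulrN1.
Qed.

End Alternants.

Section ArrayGeneratingFunction.
Variables (n M : nat) (mu : nat -> nat) (d : nat).
Implicit Types w : array n M.

Definition sizes w : {ffun 'I_n -> nat} := [ffun j : 'I_n => row_size w j].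

(** A cut at 0 makes the exchange concern the whole rows, and its condition is void. *)
Lemma row_size_swap_tail0 j w k : j.+1 < n -> (forall i, sparse (entry w i)) ->
  row_size (swap_tail 0 j w) k = row_size w (swap j k).
Proof.
move=> jn sw; rewrite /swap /row_size; case: (eqVneq k j) => [->|kj].
  by rewrite (@swap_tail_size_top _ _ 0 j w jn).
case: (eqVneq k j.+1) => [->|kj1].
  by rewrite (@swap_tail_size_bot _ _ 0 j w jn).
by apply: eq_bigr => v _; rewrite swap_tail_off ?kj.
Qed.

(** Exchanges of adjacent rows give the adjacent transpositions, which generate all permutations. An
    arbitrary [G] covers both the monomials of the generating function and the indicator of
    prescribed row sizes. *)
Lemma sum_sizes_perm (R : nmodType) (G : {ffun 'I_n -> nat} -> R) (s : 'S_n) :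
  (\sum_(w | valid mu d w) G (sizes w)
   = \sum_(w | valid mu d w) G [ffun i => sizes w (s i)])%R.
Proof.
(* [P] quantifies over the function because the step for a product of permutations applies it to a
   composite. *)
pose P (t : 'S_n) := forall G : {ffun 'I_n -> nat} -> R,
  (\sum_(w | valid mu d w) G (sizes w)
   = \sum_(w | valid mu d w) G [ffun i => sizes w (t i)])%R.
have P1 : P 1%g.
  move=> H; apply: eq_bigr => w _; congr H.
  by apply/ffunP => i; rewrite !ffunE perm1.
have PM t u : P t -> P u -> P (t * u)%g.
  move=> Pt Pu H; rewrite Pt (Pu (fun c => H [ffun i => c (t i)])).
  by apply: eq_bigr => w _; congr H; apply/ffunP => i; rewrite !ffunE permM.
have Padj (i1 i2 : 'I_n) : i2 = i1.+1 :> nat -> P (tperm i1 i2).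
  move=> i12 H; have jn : i1.+1 < n by rewrite -i12.
  rewrite (reindex_inj (inv_inj (fun w : array n M => swap_tailK 0 w jn))).
  have vE w : valid mu d (swap_tail 0 i1 w) = valid mu d w.
    apply/idP/idP; last exact: swap_tail_valid.
    by rewrite -{2}(swap_tailK 0 w jn); apply: swap_tail_valid.
  rewrite (eq_bigl _ _ vE); apply: eq_bigr => w /asboolP [sw _ _].
  congr H; apply/ffunP => i; rewrite !ffunE row_size_swap_tail0 //.
  congr row_size; rewrite /swap; case: tpermP => [->|->|].
  - by rewrite eqxx.
  - by rewrite i12 eqxx gtn_eqF.
  - by rewrite -i12 !val_eqE => /eqP /negbTE-> /eqP /negbTE->.
have Plt k (i1 i2 : 'I_n) : i2 = (i1 + k).+1 :> nat -> P (tperm i1 i2).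
  elim: k i2 => [|k IHk] i2 i12; first by apply: Padj; rewrite i12 addn0.
  have kn : (i1 + k).+1 < n by have := ltn_ord i2; lia.
  pose i3 := Ordinal kn.
  (* Conjugation by an adjacent transposition lengthens a transposition by one. *)
  have -> : tperm i1 i2 = (tperm i1 i3 ^ tperm i3 i2)%g.
    rewrite tpermJ tpermL tpermD // -val_eqE /=; lia.
  have Q : P (tperm i3 i2) by apply: Padj; rewrite i12 addnS.
  by rewrite conjgE tpermV; apply: (PM) => //; apply: (PM) => //; apply: IHk.
have Pt (i1 i2 : 'I_n) : P (tperm i1 i2).
  case: (ltngtP i1 i2) => h.
  - by apply: (Plt (i2 - i1.+1)); lia.
  - by rewrite tpermC; apply: (Plt (i1 - i2.+1)); lia.
  - by rewrite (val_inj h) tperm1.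
have [ts -> _] := prod_tpermP s.
by elim: ts G => [|t ts IH] G; rewrite ?big_nil ?big_cons; [apply: P1|apply: PM].
Qed.

Variables (R : comNzRingType) (x : nat -> R).

Definition array_gf : R :=
  (\sum_(w : array n M | valid mu d w) \prod_(j < n) x j ^+ row_size w j)%R.

(** For each permutation in the expansion of the determinant, symmetry lets the row sizes be
    permuted in the same way; each product is then a term of an alternant with the sizes added to
    the exponents. *)
Lemma array_gf_alternant :
  (array_gf * alternant n x (fun j => n.-1 - j)%N
   = \sum_(w : array n M | valid mu d w)
       alternant n x (fun j => row_size w j + (n.-1 - j))%N)%R.
Proof.
rewrite /alternant /determinant exchange_big /= mulr_sumr.
apply: eq_bigr => s _; rewrite mulrCA -mulr_sumr; congr (_ * _)%R.
have -> : array_gf = (\sum_(w : array n M | valid mu d w)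
    \prod_(j < n) x j ^+ row_size w (s j))%R.
  rewrite [LHS](eq_bigr (fun w => \prod_(j < n) x j ^+ sizes w j)%R).
    rewrite (sum_sizes_perm (fun c => \prod_(j < n) x j ^+ c j)%R s).
    by apply: eq_bigr => w _; apply: eq_bigr => j _; rewrite !ffunE.
  by move=> w _; apply: eq_bigr => j _; rewrite ffunE.
rewrite mulr_suml; apply: eq_bigr => w _; rewrite -big_split.
by apply: eq_bigr => j _; rewrite !mxE exprD.
Qed.

End ArrayGeneratingFunction.

(** * Flaws, and the sign-reversing involution *)

Section Flaws.
Variables (n M : nat) (mu : nat -> nat) (d : nat).
Implicit Types w : array n M.

Definition head w k p := \sum_(v < M) ((v < p) && entry w k v).

Lemma head0 w k : head w k 0 = 0.
Proof. by rewrite /head big1. Qed.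

Lemma headS w k p : head w k p.+1 = head w k p + entry w k p.
Proof.
have -> : nat_of_bool (entry w k p) = \sum_(v < M) ((v == p :> nat) && entry w k v).
  case: (ltnP p M) => pM; last first.
    rewrite entry_col // big1 // => v _.
    by rewrite ltn_eqF // (leq_trans (ltn_ord v)).
  rewrite (bigD1 (Ordinal pM)) //= eqxx big1 ?addn0 // => v.
  by rewrite -val_eqE /= => /negbTE->.
rewrite -big_split; apply: eq_bigr => v _ /=.
by rewrite ltnS leq_eqVlt; case: ltngtP => //=; case: (entry w k v).
Qed.

Lemma row_size_head w k p :
  row_size w k = head w k p + \sum_(v < M) ((p <= v) && entry w k v).
Proof.
rewrite -big_split; apply: eq_bigr => v _ /=.
by rewrite ltnNge; case: (p <= v); rewrite //= addn0.
Qed.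

(* No flaw means that the p-th entries a, b of rows j and j+1 satisfy
   a <= b + 1, and that row j+1 is not longer than row j. *)
Definition flaw w v j := head w j v.+2 < head w j.+1 v.+1.

Definition flawed w v := has (flaw w v) (iota 0 n.-1).

Definition flawless w := ~~ has (flawed w) (iota 0 M).

Definition first_flaw w :=
  let v := find (flawed w) (iota 0 M) in (v, find (flaw w v) (iota 0 n.-1)).

Lemma first_flawP w v j : ~~ flawless w -> first_flaw w = (v, j) ->
  [/\ v < M, j.+1 < n, flaw w v j & forall u, u < v -> ~~ flawed w u].
Proof.
rewrite negbK => fw [].
set v0 := find _ _ => <-.
have v0M : v0 < M by move: fw; rewrite has_find size_iota.
have /= fv : flawed w v0.
  by have := nth_find 0 fw; rewrite nth_iota ?add0n.
have j0n : find (flaw w v0) (iota 0 n.-1) < n.-1.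
  by move: (fv); rewrite /flawed has_find size_iota.
move=> <-; split=> //; first by lia.
  by have := nth_find 0 fv; rewrite nth_iota ?add0n.
move=> u uv; have := before_find 0 uv; rewrite nth_iota ?add0n //.
  by move=> ->.
exact: ltn_trans v0M.
Qed.

(** With no flaw before [v], the flaw can only arise because row [j.+1] contains [v] while row [j]
    lacks [v.+1]; sparseness keeps [v.+1] out of row [j.+1] too. Hence a cut at [v.+2] splits no
    run, and the counts before it differ by exactly one, the difference of consecutive parts of
    delta. *)
Lemma first_flaw_gap w v j : ~~ flawless w -> first_flaw w = (v, j) ->
    sparse (entry w j.+1) ->
  [/\ entry w j v.+1 = false, entry w j.+1 v.+1 = false
    & head w j.+1 v.+2 = (head w j v.+2).+1].
Proof.
move=> fw fwE sB; have [vM jn fv min] := first_flawP fw fwE.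
have le : head w j.+1 v <= head w j v.+1.
  case: v vM fv min {fwE} => [|v] vM fv min; first by rewrite head0.
  rewrite leqNgt; apply/negP => h; case/negP: (min v (ltnSn v)).
  by apply/hasP; exists j => //; rewrite mem_iota; lia.
rewrite headS in le; move: fv (sB v); rewrite /flaw !headS.
case: (entry w j.+1 v) => /=; case: (entry w j v.+1) => /= h; try (exfalso; lia).
by move=> /negbTE->; split=> //; lia.
Qed.

(** A flaw at a position up to [v] depends only on positions below [v.+2], where nothing is
    exchanged. *)
Lemma swap_tail_first_flaw w v j : ~~ flawless w -> first_flaw w = (v, j) ->
  let w' := swap_tail v.+2 j w in ~~ flawless w' /\ first_flaw w' = (v, j).
Proof.
move=> fw fwE w'; have [vM jn fv min] := first_flawP fw fwE.
have heq k p : p <= v.+2 -> head w' k p = head w k p.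
  move=> pv; apply: eq_bigr => u _; case: ltnP => //= up.
  by rewrite swap_tail_head // (leq_trans up).
have feq u : u <= v -> flaw w' u =1 flaw w u.
  by move=> uv k; rewrite /flaw !heq // ltnW.
have ffeq u : u <= v -> flawed w' u = flawed w u.
  by move=> uv; apply: eq_has; apply: feq.
have fwv : flawed w v by apply/hasP; exists j => //; rewrite mem_iota; lia.
have fw' : ~~ flawless w'.
  by rewrite negbK; apply/hasP; exists v; rewrite ?mem_iota ?add0n ?ffeq.
split=> //; have [vE] := fwE.
rewrite vE => jE; rewrite /first_flaw.
suff -> : find (flawed w') (iota 0 M) = v by rewrite (eq_find (feq v _)) ?jE.
apply/eqP; rewrite eqn_leq; apply/andP; split; rewrite leqNgt; apply/negP => h.
  have := before_find 0 h; rewrite nth_iota ?add0n //.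
  by rewrite ffeq ?fwv.
have : flawed w' (find (flawed w') (iota 0 M)).
  have hs : find (flawed w') (iota 0 M) < M by apply: ltn_trans vM.
  have := @nth_find _ 0 (flawed w') (iota 0 M); rewrite nth_iota ?add0n //.
  by apply; rewrite -[has _ _]negbK.
by apply/negP; rewrite ffeq ?min // ltnW.
Qed.

Definition flaw_swap w :=
  if flawless w then w else
  let: (v, j) := first_flaw w in swap_tail v.+2 j w.

Lemma flaw_swapK : involutive flaw_swap.
Proof.
move=> w; rewrite /flaw_swap; case: (boolP (flawless w)) => [->|fw] //.
case fE: (first_flaw w) => [v j].
have [vM jn _ _] := first_flawP fw fE.
have [fw' ->] := swap_tail_first_flaw fw fE.
by rewrite (negbTE fw') swap_tailK.
Qed.

Lemma flaw_swap_valid w : valid mu d (flaw_swap w) = valid mu d w.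
Proof.
suff imp u : valid mu d u -> valid mu d (flaw_swap u).
  by apply/idP/idP => /imp; rewrite ?flaw_swapK.
rewrite /flaw_swap; case: (boolP (flawless u)) => [//|fw].
case fE: (first_flaw u) => [v j] vu.
have [vM jn _ _] := first_flawP fw fE.
have /asboolP [su _ _] := vu.
have [e1 e2 _] := first_flaw_gap fw fE (su _).
by apply: swap_tail_valid => // i [->]; rewrite e1 e2.
Qed.

Lemma flaw_swap_flawless w : flawless (flaw_swap w) = flawless w.
Proof.
rewrite {1}/flaw_swap; case: (boolP (flawless w)) => [-> //|fw].
case fE: (first_flaw w) => [v j].
by have [/negbTE] := swap_tail_first_flaw fw fE.
Qed.

Variables (R : comNzRingType) (x : nat -> R).

Local Open Scope ring_scope.

Let alt w := alternant n x (fun j => row_size w j + (n.-1 - j))%N.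

(** If rows [j] and [j.+1] had sizes a and b, the new ones have sizes b - 1 and a + 1; with delta
    added, the two exponents are exactly transposed. *)
Lemma flaw_swap_alternant w : valid mu d w -> ~~ flawless w ->
  alt (flaw_swap w) = - alt w.
Proof.
move=> vw fw; rewrite /flaw_swap (negbTE fw).
case fE: (first_flaw w) => [v j].
have [vM jn _ _] := first_flawP fw fE.
have /asboolP [sw _ _] := vw.
have [e1 e2 e3] := first_flaw_gap fw fE (sw _).
have cut u : u.+1 = v.+2 -> entry w j u = entry w j.+1 u.
  by move=> [->]; rewrite e1 e2.
pose j1 := Ordinal (ltnW jn); pose j2 := Ordinal jn.
have hd k : head (swap_tail v.+2 j w) k v.+2 = head w k v.+2.
  by apply: eq_bigr => u _; case: ltnP => //= up; rewrite swap_tail_head.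
apply: (@alternant_tperm _ _ _ _ _ j1 j2); first by rewrite -val_eqE /=; lia.
move=> k /=; rewrite !(row_size_head _ _ v.+2) hd.
case: tpermP => [->|->|/eqP kj1 /eqP kj2] /=.
- by rewrite (swap_tail_size_top jn cut sw) e3; set t := bigop _ _ _; lia.
- by rewrite (swap_tail_size_bot jn cut sw) e3; set t := bigop _ _ _; lia.
- congr (_ + _ + _)%N; apply: eq_bigr => u _; rewrite swap_tail_off //.
  by rewrite -!val_eqE in kj1 kj2; rewrite kj1 kj2.
Qed.

End Flaws.

Theorem array_gf_flawless (R : idomainType) (x : nat -> R) n M mu d :
    (1 + 1 != 0 :> R)%R ->
  (array_gf n M mu d x * alternant n x (fun j => n.-1 - j)%N
   = \sum_(w : array n M | valid mu d w && flawless w)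
       alternant n x (fun j => row_size w j + (n.-1 - j))%N)%R.
Proof.
move=> two; rewrite array_gf_alternant (bigID (@flawless n M)) /=.
set S := (X in (_ + X = _)%R); suff -> : S = 0%R by rewrite addr0.
(* The involution can fix an array, whose alternant then has two equal exponents. Deducing [S = 0]
   from [S = - S] spares a separate treatment of these. *)
have SN : S = (- S)%R.
  rewrite {1}/S (reindex_inj (inv_inj (@flaw_swapK n M))) -sumrN.
  apply: eq_big => w; first by rewrite flaw_swap_valid flaw_swap_flawless.
  by rewrite flaw_swap_valid flaw_swap_flawless => /andP [vw fw]; rewrite
  (flaw_swap_alternant _ vw fw).
apply/eqP; move/eqP: SN; rewrite -addr_eq0 -{1}[S]mul1r -{2}[S]mul1r -mulrDl mulf_eq0.
by rewrite (negbTE two).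
Qed.

(** * Branching rules and the bialternant formula *)

Fixpoint seqprod (rs : seq (seq nat)) : seq (seq nat) :=
  if rs is r :: rs' then [seq b :: bs | b <- r, bs <- seqprod rs'] else [:: [::]].

Lemma mem_seqprod rs bs : bs \in seqprod rs =
  (size bs == size rs) && all (fun j => nth 0 bs j \in nth [::] rs j) (iota 0 (size rs)).
Proof.
elim: rs bs => [|r rs IH] [|b bs] //=; first by apply/allpairsP => [[[? ?] /= []]].
rewrite eqSS -[1]addn0 iotaDl all_map andbCA.
rewrite -[all _ _]/(all (fun j => nth 0 bs j \in nth [::] rs j) (iota 0 (size rs))) -IH.
apply/allpairsP/andP => [[[b' bs'] /= [? ? [-> ->]]] //|[rb rbs]].
by exists (b, bs).
Qed.

Lemma seqprod_uniq rs : all uniq rs -> uniq (seqprod rs).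
Proof.
elim: rs => //= r rs IH /andP [ur urs]; apply: allpairs_uniq; rewrite ?IH //.
by move=> [b bs] [b' bs'] _ _ [-> ->].
Qed.

Lemma prod_sum_seqprod (R : comPzSemiRingType) (rs : seq (seq nat)) (g : nat -> nat -> R) :
  (\prod_(j < size rs) \sum_(b <- nth [::] rs j) g j b
   = \sum_(bs <- seqprod rs) \prod_(j < size rs) g j (nth 0%N bs j))%R.
Proof.
elim: rs g => [|r rs IH] g /=; first by rewrite big_seq1 !big_ord0.
rewrite big_ord_recl /= (IH (fun j => g j.+1)) big_distrl /= big_allpairs_dep /=.
apply: eq_bigr => b _; rewrite big_distrr /=.
by apply: eq_bigr => bs _; rewrite big_ord_recl.
Qed.

Definition decreasing (lam : seq nat) := forall j, nth 0 lam j.+1 <= nth 0 lam j.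

(** For a partition [lam] with at most [k.+1] parts, the shapes that remain when a horizontal strip
    containing all of row [k] is removed. As a product of intervals, the list matches the expansion
    of a determinant whose columns are sums. *)
Definition interlacing (k : nat) (lam : seq nat) : seq (seq nat) :=
  seqprod (mkseq (fun j =>
    iota (nth 0 lam j.+1) (nth 0 lam j - nth 0 lam j.+1).+1) k).

Lemma interlacingP k lam mu : decreasing lam ->
  reflect (size mu = k /\ forall j, j < k ->
             nth 0 lam j.+1 <= nth 0 mu j <= nth 0 lam j)
          (mu \in interlacing k lam).
Proof.
move=> dl; rewrite mem_seqprod size_mkseq.
apply: (iffP andP) => [[/eqP <- /allP h]|[-> h]]; split=> //.
  move=> j jk; have := h j; rewrite mem_iota add0n jk => /(_ isT).
  by rewrite nth_mkseq // mem_iota; have := dl j; lia.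
apply/allP => j; rewrite mem_iota add0n => /andP [_ jk]; rewrite nth_mkseq // mem_iota.
by have := dl j; have := h j jk; lia.
Qed.

Lemma interlacing_decreasing k lam mu : decreasing lam ->
  mu \in interlacing k lam -> decreasing mu.
Proof.
move=> dl /(interlacingP _ _ dl) [szmu h] j.
case: (ltnP j.+1 k) => jk; last by rewrite nth_default ?szmu.
by have := h _ jk; have := h _ (ltnW jk); lia.
Qed.

Lemma interlacing_nil k : interlacing k [::] = [:: nseq k 0].
Proof.
rewrite /interlacing; have -> : mkseq (fun j =>
    iota (nth 0 [::] j.+1) (nth 0 [::] j - nth 0 [::] j.+1).+1) k = nseq k [:: 0].
  by apply: (@eq_from_nth _ [::]) => [|j]; rewrite size_mkseq ?size_nseq // => jk;
    rewrite nth_mkseq // nth_nseq jk !nth_nil.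
by elim: k => //= k ->.
Qed.

Section Branching.
Variables (R : comNzRingType) (x : nat -> R).

Local Open Scope ring_scope.

Definition staircase_alternant n lam : R :=
  alternant n x (fun j => nth 0%N lam j + (n.-1 - j))%N.

(* Subtracting x_k^(e_j - e_(j+1)) times column j+1 from column j clears the
   last row, and leaves a multiple of x_i - x_k in row i. *)
Lemma alternant_column_ops k lam : decreasing lam ->
  staircase_alternant k.+1 lam = x k ^+ nth 0%N lam k
    * (\prod_(i < k) (x i - x k)
       * \det (\matrix_(i < k, j < k)
           \sum_(m <- iota (nth 0%N lam j.+1) (nth 0 lam j - nth 0 lam j.+1).+1%N)
              x i ^+ (m + (k.-1 - j))%N * x k ^+ (nth 0 lam j - m)%N)).
Proof.
move=> dl; rewrite /staircase_alternant /alternant /=.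
set e := fun j => (nth 0 lam j + (k - j))%N.
pose A := \matrix_(i < k.+1, j < k.+1) x i ^+ e j.
pose U := \matrix_(i < k.+1, j < k.+1)
  ((i == j)%:R - (i == j.+1 :> nat)%:R * x k ^+ (e j - e j.+1)%N).
have detU : \det U = 1.
  rewrite det_trig; last first.
    apply/is_trig_mxP => i j ij; rewrite mxE -val_eqE !ltn_eqF //=.
      by rewrite mul0r subr0.
    exact: ltn_trans ij _.
  by rewrite big1 // => i _; rewrite mxE eqxx ltn_eqF // mul0r subr0.
have -> : \det A = \det (A *m U) by rewrite det_mulmx detU mulr1.
have AU (i j : 'I_k.+1) : (A *m U) i j =
  if (j < k)%N then x i ^+ e j - x i ^+ e j.+1 * x k ^+ (e j - e j.+1)%N else x i ^+ e j.
  rewrite mxE; under eq_bigr => l _ do rewrite !mxE mulrBr.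
  rewrite sumrB (bigD1 j) //= eqxx mulr1 big1 ?addr0; last first.
    by move=> l /negbTE ->; rewrite mulr0.
  case: ifP => jk; last first.
    rewrite big1 ?subr0 // => l _; rewrite ltn_eqF ?mul0r ?mulr0 //.
    by have := ltn_ord l; have := ltn_ord j; lia.
  have jk' : (j.+1 < k.+1)%N by [].
  rewrite (bigD1 (Ordinal jk')) //= eqxx mul1r big1 ?addr0 // => l.
  by rewrite -val_eqE /= => /negbTE->; rewrite mul0r mulr0.
(* The exponents decrease strictly, so truncated subtraction is exact; the gap is the number of
   terms of the geometric sum obtained on dividing by [x i - x k]. *)
have eS j : (j < k)%N -> e j = (nth 0 lam j - nth 0 lam j.+1 + e j.+1).+1%N.
  by move=> jk; rewrite /e; have := dl j; lia.
rewrite (expand_det_row _ ord_max) (bigD1 ord_max) //= AU ltnn.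
rewrite big1 ?addr0; last first.
  move=> j; rewrite -val_eqE /= => jk; rewrite AU.
  have jk' : (j < k)%N by have := ltn_ord j; lia.
  rewrite jk' -exprD subnKC ?subrr ?mul0r //.
  by rewrite (eS _ jk') leqW // leq_addl.
rewrite /cofactor addnn -mul2n exprM sqrrN !expr1n mul1r.
congr (_ ^+ _ * _); first by rewrite /e subnn addn0.
have -> : \prod_(i < k) (x i - x k) = \det (diag_mx (\row_(i < k) (x i - x k))).
  by rewrite det_diag; apply: eq_bigr => i _; rewrite mxE.
rewrite -det_mulmx; congr (\det _); apply/matrixP => i j.
rewrite mul_diag_mx [LHS]mxE [LHS]mxE AU !lift_max ltn_ord ![in RHS]mxE.
rewrite -[_ :: _]/(iota _ _.+1).
have jk : (j < k)%N := ltn_ord j.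
set D := (nth 0 lam j - nth 0 lam j.+1)%N.
have -> : (e j - e j.+1)%N = D.+1 by rewrite eS // -/D -addSn addnK.
rewrite eS // -/D -addSn exprD mulrC -mulrBr -opprB subrXX -mulNr opprB mulrCA.
congr (_ * _); rewrite -[nth 0%N lam j.+1 in RHS]addn0 iotaDl big_map.
rewrite -[D.+1 in RHS]subn0 -/(index_iota 0 D.+1) big_mkord mulr_sumr.
apply: eq_bigr => t _; rewrite mulrCA mulrC -exprD; congr (_ ^+ _ * _ ^+ _).
  by rewrite /e addnAC -[k.-1]subn1 -subnDA add1n.
by rewrite subnDA.
Qed.

(** Column [j] of the reduced determinant is a sum over the possible values of part [j] of [mu], so
    multilinearity in the columns gives a sum over all [mu]. Transposing makes the products in the
    determinant run over columns. *)
Lemma alternant_branching k lam : decreasing lam ->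
  staircase_alternant k.+1 lam = x k ^+ nth 0%N lam k * \prod_(i < k) (x i - x k)
    * \sum_(mu <- interlacing k lam)
        x k ^+ (\sum_(j < k) (nth 0 lam j - nth 0 mu j))%N * staircase_alternant k mu.
Proof.
move=> dl; rewrite alternant_column_ops // -mulrA; congr (_ * (_ * _)).
rewrite -det_tr /determinant.
under [RHS]eq_bigr => mu _ do rewrite /staircase_alternant /alternant -det_tr mulr_sumr.
rewrite exchange_big /=; apply: eq_bigr => s _.
under [RHS]eq_bigr => mu _ do rewrite mulrCA.
rewrite -mulr_sumr; congr (_ * _).
pose rs := mkseq (fun j =>
  iota (nth 0 lam j.+1) (nth 0 lam j - nth 0 lam j.+1).+1)%N k.
pose s' (j : nat) : nat := if insub j is Some i then s i else 0.
have s'E (i : 'I_k) : s' i = s i by rewrite /s' valK.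
have szr : k = size rs by rewrite size_mkseq.
pose g j m := x (s' j) ^+ (m + (k.-1 - j))%N * x k ^+ (nth 0 lam j - m)%N.
transitivity (\prod_(j < k) \sum_(m <- nth [::] rs j) g j m).
  apply: eq_bigr => i _; rewrite !mxE nth_mkseq //.
  by apply: eq_bigr => m _; rewrite /g s'E.
have := prod_sum_seqprod rs g; rewrite -szr => ->.
apply: eq_bigr => mu _; rewrite expr_sum -big_split; apply: eq_bigr => i _.
by rewrite !mxE /g s'E mulrC.
Qed.

End Branching.

Definition add_strip (k : nat) (lam : seq nat) (T : seq (seq nat)) : seq (seq nat) :=
  mkseq (fun j => nth [::] T j ++ nseq (nth 0 lam j - size (nth [::] T j)) k) k.+1.

(* The semistandard tableaux of shape lam with entries below n, as lists of n
   possibly empty rows, built by adding one horizontal strip per letter. *)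
Fixpoint ssyt (n : nat) (lam : seq nat) : seq (seq (seq nat)) :=
  if n is k.+1 then
    [seq add_strip k lam T | mu <- interlacing k lam, T <- ssyt k mu]
  else [:: [::]].

Lemma ssyt_shape n lam T : decreasing lam -> T \in ssyt n lam ->
  size T = n /\ forall j, j < n -> size (nth [::] T j) = nth 0 lam j.
Proof.
elim: n lam T => [|k IH] lam T dl /=; first by rewrite inE => /eqP ->.
move=> /allpairsPdep [mu [T' [muP T'P ->]]]; rewrite size_mkseq; split=> // j jk.
have [sz rows] := IH _ _ (interlacing_decreasing dl muP) T'P.
rewrite nth_mkseq // size_cat size_nseq subnKC //.
have [szmu h] := interlacingP _ _ dl muP.
move: jk; rewrite ltnS leq_eqVlt => /orP [/eqP ->|jk]; last by rewrite rows //; have := h j jk; lia.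
by rewrite nth_default // sz.
Qed.

Section Bialternant.
Variables (R : comNzRingType) (x : nat -> R).

Local Open Scope ring_scope.

Definition tableau_monomial (T : seq (seq nat)) : R := \prod_(t <- flatten T) x t.

Definition schur_poly n lam : R := \sum_(T <- ssyt n lam) tableau_monomial T.

Lemma prod_nseq m k : \prod_(t <- nseq m k) x t = x k ^+ m.
Proof. by elim: m => [|m IH] /=; rewrite ?big_nil ?big_cons ?IH ?exprS. Qed.

Lemma tableau_monomial_rows T n : size T = n ->
  tableau_monomial T = \prod_(j < n) \prod_(t <- nth [::] T j) x t.
Proof.
move=> <-; rewrite /tableau_monomial.
by rewrite big_flatten /= (big_nth [::]) big_mkord.
Qed.

Lemma schur_poly_branching k lam : decreasing lam ->
  schur_poly k.+1 lam = x k ^+ nth 0%N lam k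
    * \sum_(mu <- interlacing k lam)
        x k ^+ (\sum_(j < k) (nth 0 lam j - nth 0 mu j))%N * schur_poly k mu.
Proof.
move=> dl; rewrite /schur_poly /= big_allpairs_dep /= mulr_sumr.
rewrite big_seq [RHS]big_seq; apply: eq_bigr => mu muP.
rewrite mulrA mulr_sumr big_seq [RHS]big_seq; apply: eq_bigr => T TP.
have [szT rows] := ssyt_shape (interlacing_decreasing dl muP) TP.
rewrite (@tableau_monomial_rows _ k.+1) ?size_mkseq // (tableau_monomial_rows szT).
rewrite big_ord_recr /= nth_mkseq // nth_default ?szT // cat0s.
rewrite subn0 prod_nseq mulrC -mulrA; congr (_ * _).
rewrite expr_sum -big_split; apply: eq_bigr => j _ /=.
by rewrite nth_mkseq ?ltnS 1?ltnW // big_cat /= prod_nseq rows // mulrC.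
Qed.

Lemma staircase_alternant0 k :
  staircase_alternant x k.+1 [::]
  = \prod_(i < k) (x i - x k) * staircase_alternant x k [::].
Proof.
rewrite alternant_branching; last by move=> j; rewrite !nth_nil.
rewrite interlacing_nil big_seq1 nth_nil expr0 mul1r.
rewrite [(\sum_(j < k) _)%N]big1 ?expr0 ?mul1r; last by move=> j _; rewrite nth_nil.
by congr (_ * _); apply: eq_alternant => j jk; rewrite nth_nil nth_nseq if_same.
Qed.

(** Alternants and Schur polynomials branch over the same [mu] with the same powers of the last
    variable. The product of differences that only alternants carry is supplied by
    [staircase_alternant0]. *)
Theorem bialternant n lam : decreasing lam ->
  schur_poly n lam * staircase_alternant x n [::] = staircase_alternant x n lam.
Proof.
elim: n lam => [|k IH] lam dl.
  by rewrite /schur_poly big_seq1 /tableau_monomial big_nil mul1r /staircase_alternant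
    /alternant !det_mx00.
rewrite schur_poly_branching // staircase_alternant0 alternant_branching //.
rewrite -!mulrA; congr (_ * _); rewrite mulrCA; congr (_ * _).
rewrite mulr_suml big_seq [RHS]big_seq; apply: eq_bigr => mu muP.
by rewrite -mulrA IH //; apply: interlacing_decreasing muP.
Qed.

End Bialternant.

(** * The recursive list of semistandard tableaux is complete and free of repetitions *)

Lemma sorted_strip (k : nat) (r : seq nat) : sorted leq r -> all (fun t => t <= k) r ->
  r = filter (fun t => t < k) r ++ nseq (size r - size (filter (fun t => t < k) r)) k.
Proof.
elim: r => //= a r IH pr /andP [ak rk].
case: ltnP => ka /=; first by rewrite subSS -IH // (path_sorted pr).
have aE : a = k by apply/eqP; rewrite eqn_leq ak.
have rE : all (fun t => t == k) r.
  have := order_path_min leq_trans pr; rewrite aE => kr.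
  by apply/allP => t tr; rewrite eqn_leq (allP rk) // (allP kr).
have -> : [seq t <- r | t < k] = [::].
  by apply/eqP; rewrite -[_ == _]negbK -has_filter; apply/hasPn => t /(allP rE) /eqP ->;
    rewrite ltnn.
by rewrite aE /=; congr cons; apply/all_pred1P.
Qed.

Lemma filter_strip (k m : nat) (r : seq nat) : all (fun t => t < k) r ->
  filter (fun t => t < k) (r ++ nseq m k) = r.
Proof.
move=> rk; rewrite filter_cat (all_filterP rk) -[RHS]cats0; congr cat.
by elim: m => //= m ->; rewrite ltnn.
Qed.

Definition bounded_rows n (T : seq (seq nat)) := forall j, all (fun t => t < n) (nth [::] T j).

Lemma semistandard_nth lam T : decreasing lam -> semistandard lam T ->
  [/\ size T = size lam, forall j, size (nth [::] T j) = nth 0 lam j,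
      forall j, sorted leq (nth [::] T j) &
      forall j p, p < nth 0 lam j.+1 ->
        nth 0 (nth [::] T j) p < nth 0 (nth [::] T j.+1) p].
Proof.
move=> dl [sh so co]; subst lam.
have szr j : size (nth [::] T j) = nth 0 (shape T) j.
  case: (ltnP j (size T)) => jT; first by rewrite (nth_map [::]).
  by rewrite !nth_default ?size_map.
split=> //; first by rewrite size_map.
  move=> j; case: (ltnP j (size T)) => jT; last by rewrite nth_default.
  by apply: (allP so); apply: mem_nth.
move=> j p pl; apply: co; rewrite szr //; exact: leq_trans pl (dl j).
Qed.

Lemma nth_add_strip k lam T j : j < k.+1 -> nth [::] (add_strip k lam T) j
  = nth [::] T j ++ nseq (nth 0 lam j - size (nth [::] T j)) k.
Proof. by move=> jk; rewrite nth_mkseq. Qed.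

(** The largest letter occupies a horizontal strip at the ends of the rows, and what remains has an
    interlacing shape. Here [lam] has exactly [n] parts, zeros included, so empty rows are kept. *)
Lemma mem_ssyt n lam T : decreasing lam -> size lam = n ->
  T \in ssyt n lam <-> semistandard lam T /\ bounded_rows n T.
Proof.
elim: n lam T => [|k IH] lam T dl szl.
  rewrite inE (size0nil szl); split=> [/eqP ->|[[sh _ _] _]]; last first.
    by case: T sh.
  by split; first split=> //; move=> j; rewrite ?nth_nil // => p; rewrite nth_nil.
split.
  move=> /allpairsPdep [mu [T' [muP T'P ->]]].
  have dmu := interlacing_decreasing dl muP.
  have [szmu h] := interlacingP _ _ dl muP.
  have [ssT' bT'] := (IH mu T' dmu szmu).1 T'P.
  have [szT' rT' soT' coT'] := semistandard_nth dmu ssT'.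
  have le j : j <= k -> nth 0 mu j <= nth 0 lam j.
    rewrite leq_eqVlt => /orP [/eqP ->|/h]; last by lia.
    by rewrite nth_default ?szmu.
  split; last first.
    move=> j; case: (ltnP j k.+1) => jk; last by rewrite nth_default ?size_mkseq.
    rewrite nth_add_strip // all_cat all_nseq ltnSn orbT andbT.
    by apply: sub_all (bT' j) => t; apply: leqW.
  split.
  - apply: (@eq_from_nth _ 0); rewrite size_map size_mkseq ?szl // => j jk.
    by rewrite (nth_map [::]) ?size_mkseq // nth_add_strip // size_cat size_nseq rT' subnKC // le.
  - apply/allP => r /(nthP [::]) [j]; rewrite size_mkseq => jk <-.
    rewrite nth_add_strip // sorted_pairwise; last exact: leq_trans.
    rewrite pairwise_cat -!sorted_pairwise ?soT'; try exact: leq_trans.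
    apply/and3P; split=> //; last by elim: (_ - _) => // [[|m]] //= ->; rewrite leqnn.
    apply/allrelP => t u tT' /nseqP [-> _].
    exact: ltnW (allP (bT' j) _ tT').
  - move=> j p pj; case: (ltnP j.+1 k.+1) => jk; last first.
      by rewrite [nth _ _ j.+1]nth_default ?size_mkseq.
    rewrite !nth_add_strip //; last exact: ltnW.
    rewrite size_cat size_nseq !nth_cat !rT' => pj1.
    have pl : p < nth 0 lam j.+1 by have := le j.+1 jk; lia.
    have pm : p < nth 0 mu j by have := h j jk; lia.
    rewrite pm; case: ltnP => pm1; first exact: coT'.
    rewrite nth_nseq ltn_sub2r //.
      by apply: (allP (bT' j)); rewrite mem_nth ?rT'.
    exact: leq_ltn_trans pl.
move=> [ssT bT].
have [szT rT soT coT] := semistandard_nth dl ssT.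
rewrite szl in szT.
pose T' := mkseq (fun j => filter (fun t => t < k) (nth [::] T j)) k.
(* Strict columns force the entries of row [j] to be at least [j]; hence row [k] consists of letters
   [k] only, and [T'] can do with [k] rows. *)
have ge j p : p < nth 0 lam j -> j <= nth 0 (nth [::] T j) p.
  elim: j => // j IHj pl; apply: leq_ltn_trans (coT _ _ pl).
  exact: IHj (leq_trans pl (dl j)).
have strip j : nth [::] T j = nth [::] T' j
    ++ nseq (nth 0 lam j - size (nth [::] T' j)) k.
  case: (ltnP j k) => jk; last first.
    rewrite [nth _ T' j]nth_default ?size_mkseq //= subn0 -rT.
    apply/all_pred1P/(all_nthP 0) => p; rewrite rT => pl /=.
    have jl : j < k.+1.
      by rewrite -szl ltnNge; apply/negP => h; rewrite nth_default in pl.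
    have := ge j p pl; have /(all_nthP 0) := bT j; rewrite rT => /(_ p pl).
    by rewrite ltnS => h1 h2; rewrite eqn_leq h1 (leq_trans jk).
  by rewrite nth_mkseq // -rT; apply: sorted_strip => //; apply: sub_all (bT j).
have TE : T = add_strip k lam T'.
  apply: (@eq_from_nth _ [::]); rewrite ?size_mkseq // szT => j jk.
  by rewrite nth_add_strip.
pose mu := shape T'.
have rT' j : size (nth [::] T' j) = nth 0 mu j.
  case: (ltnP j (size T')) => jT; first by rewrite (nth_map [::]).
  by rewrite [nth [::] _ _]nth_default // nth_default // size_map.
have le j : nth 0 mu j <= nth 0 lam j.
  by have := congr1 size (strip j); rewrite size_cat size_nseq rT rT'; lia.
have szmu : size mu = k by rewrite size_map size_mkseq.
have nthT j p : p < nth 0 mu j -> nth 0 (nth [::] T' j) p = nth 0 (nth [::] T j) p.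
  by move=> pm; rewrite strip nth_cat rT' pm.
have muP : mu \in interlacing k lam.
  (* Otherwise the first [k] of row [j] would have an entry below it, which would have to exceed
     [k]. *)
  apply/(interlacingP _ _ dl); split=> // j jk; rewrite le andbT leqNgt; apply/negP => ml.
  have := coT j _ ml; rewrite {1}strip nth_cat rT' ltnn nth_nseq subnn subn_gt0.
  rewrite (leq_trans ml (dl j)) => h.
  have /(all_nthP 0) := bT j.+1; rewrite rT => /(_ _ ml); lia.
have dmu := interlacing_decreasing dl muP.
rewrite TE; apply/allpairsPdep; exists mu, T'; split=> //.
apply/(IH mu T' dmu szmu); split; last first.
  move=> j; case: (ltnP j k) => jk; last by rewrite nth_default ?size_mkseq.
  by rewrite nth_mkseq ?filter_all.
split=> //.
- apply/allP => r /mapP [j _ ->]; exact: (sorted_filter leq_trans).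
- move=> j p; rewrite !rT' => pj pj1; rewrite !nthT //.
  exact: coT (leq_trans pj1 (le _)).
Qed.

(** Deleting the letters [k] gives back the smaller tableau, and its shape gives back [mu]. *)
Lemma ssyt_uniq n lam : decreasing lam -> uniq (ssyt n lam).
Proof.
elim: n lam => //= k IH lam dl.
have prop mu T : mu \in interlacing k lam -> T \in ssyt k mu ->
    [/\ size T = k, shape T = mu & bounded_rows k T].
  move=> muP TP; have dmu := interlacing_decreasing dl muP.
  have [szmu _] := interlacingP _ _ dl muP.
  have [[sh _ _] bT] := (mem_ssyt T dmu szmu).1 TP.
  by split=> //; rewrite -szmu -sh size_map.
apply: allpairs_uniq_dep.
- by apply: seqprod_uniq; apply/allP => r /mapP [j _ ->]; apply: iota_uniq.
- by move=> mu muP; apply: IH; apply: interlacing_decreasing muP.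
move=> _ _ /allpairsPdep [mu [T [muP TP ->]]] /allpairsPdep [mu' [T' [muP' TP' ->]]] /= e.
have [szT shT bT] := prop _ _ muP TP.
have [szT' shT' bT'] := prop _ _ muP' TP'.
suff TT : T = T' by move: TP TP' shT'; rewrite -TT -shT => _ _ ->.
apply: (@eq_from_nth _ [::]); rewrite ?szT ?szT' // => j jk.
have := congr1 (fun U => filter (fun t => t < k) (nth [::] U j)) e.
by rewrite /= !nth_add_strip ?(leqW jk) // !filter_strip.
Qed.

(** * The Schur expansion for arrays, and its coefficients *)

Section FlawlessShapes.
Variables n M : nat.
Implicit Types w : array n M.

Lemma head_full w k p : M <= p -> head w k p = row_size w k.
Proof. by move=> Mp; apply: eq_bigr => v _; rewrite (leq_trans (ltn_ord v)). Qed.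

Lemma row_size_out w k : n <= k -> row_size w k = 0.
Proof. by move=> nk; rewrite /row_size big1 // => v _; rewrite entry_row. Qed.

Lemma flawlessP w :
  reflect (forall j v, head w j.+1 v.+1 <= head w j v.+2) (flawless w).
Proof.
apply: (iffP hasPn) => [h j v|h v _]; last first.
  by apply/hasPn => j _; rewrite /flaw -leqNgt.
have small u : u < M -> head w j.+1 u.+1 <= head w j u.+2.
  move=> uM; case: (ltnP j n.-1) => jn; last first.
    by rewrite /head big1 // => i _; rewrite entry_row ?andbF //; lia.
  have := h u; rewrite mem_iota add0n /= => /(_ uM) /hasPn /(_ j).
  by rewrite mem_iota add0n /= => /(_ jn); rewrite /flaw -leqNgt.
case: (ltnP v M) => vM; first exact: small.
case: (posnP M) => M0.
  by rewrite /head big1 // => -[i iM]; exfalso; rewrite M0 in iM.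
have := small M.-1; rewrite prednK // => /(_ (leqnn _)).
by rewrite !head_full // ?ltnS; lia.
Qed.

Definition array_shape w := mkseq (row_size w) n.

Lemma nth_array_shape w j : nth 0 (array_shape w) j = row_size w j.
Proof.
case: (ltnP j n) => jn; first by rewrite nth_mkseq.
by rewrite nth_default ?size_mkseq // row_size_out.
Qed.

Lemma flawless_decreasing w : flawless w -> decreasing (array_shape w).
Proof.
move=> /flawlessP h j; rewrite !nth_array_shape.
by have := h j M; rewrite !head_full // ltnW.
Qed.

End FlawlessShapes.

Lemma digits_inj (B n : nat) (c c' : nat -> nat) :
  (forall j, j < n -> c j < B) -> (forall j, j < n -> c' j < B) ->
  \sum_(j < n) c j * B ^ j = \sum_(j < n) c' j * B ^ j ->
  forall j, j < n -> c j = c' j.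
Proof.
elim: n c c' => // n IH c c' hc hc'.
have B0 : 0 < B by apply: leq_ltn_trans (hc 0 _).
have digit (e : nat -> nat) : \sum_(j < n.+1) e j * B ^ j
    = (\sum_(j < n) e j.+1 * B ^ j) * B + e 0.
  rewrite big_ord_recl expn0 muln1 addnC big_distrl; congr (_ + _).
  by apply: eq_bigr => j _; rewrite expnSr mulnA.
rewrite !digit => e.
have e0 : c 0 = c' 0.
  by have := congr1 (modn^~ B) e; rewrite !modnMDl !modn_small ?hc ?hc'.
move: e; rewrite e0 => /addIn /eqP; rewrite eqn_pmul2r // => /eqP e [|j] jn //.
by apply: (IH (fun j => c j.+1) (fun j => c' j.+1)) => // i lt_in; [apply: hc|apply: hc'].
Qed.

Lemma size_ssyt n lam T : decreasing lam -> size lam = n -> T \in ssyt n lam ->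
  size (flatten T) = sumn lam.
Proof. by move=> dl szl /(mem_ssyt T dl szl) [[<- _ _] _]; rewrite size_flatten. Qed.

Lemma sum_count_flatten n (T : seq (seq nat)) (e : nat -> nat) : bounded_rows n T ->
  \sum_(t <- flatten T) e t = \sum_(t < n) count_mem (t : nat) (flatten T) * e t.
Proof.
move=> bT; have : all (fun t => t < n) (flatten T).
  by apply/allP => t /flattenP [r /(nthP [::]) [j _ <-]]; apply: (allP (bT j)).
elim: (flatten T) => [|a s IH] /=; first by rewrite big_nil big1.
move=> /andP [an sn]; rewrite big_cons IH //.
under [RHS]eq_bigr => t _ do rewrite mulnDl.
rewrite big_split /=; congr (_ + _).
rewrite (bigD1 (Ordinal an)) //= eqxx mul1n big1 ?addn0 // => t.
by rewrite -val_eqE /= eq_sym => /negbTE->.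
Qed.

Lemma staircase_alternant_neq0 (R : idomainType) (x : nat -> R) n :
  (forall i k, i < k < n -> x i != x k) -> (staircase_alternant x n [::] != 0)%R.
Proof.
elim: n => [|k IH] xne.
  by rewrite /staircase_alternant /alternant det_mx00 oner_neq0.
rewrite staircase_alternant0 mulf_neq0 //.
  by apply/prodf_neq0 => i _; rewrite subr_eq0 xne ?ltn_ord ?leqnn.
by apply: IH => i j /andP [ij jk]; rewrite xne ?ij ?leqW.
Qed.

Theorem array_gf_schur (R : idomainType) (x : nat -> R) n M mu d :
    (1 + 1 != 0 :> R)%R -> (forall i k, i < k < n -> x i != x k) ->
  (array_gf n M mu d x
   = \sum_(w : array n M | valid mu d w && flawless w)
       schur_poly x n (array_shape w))%R.
Proof.
move=> two xne; apply: (mulIf (staircase_alternant_neq0 xne)).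
have st : staircase_alternant x n [::] = alternant n x (fun j => n.-1 - j).
  by apply: eq_alternant => j _; rewrite nth_nil.
rewrite [RHS]mulr_suml {1}st array_gf_flawless //; apply: eq_bigr => w /andP [_ fw].
rewrite bialternant; last exact: flawless_decreasing.
by apply: eq_alternant => j _; rewrite nth_array_shape.
Qed.

(** The coefficient of the monomial with exponents [c] in [array_gf_schur], obtained by Kronecker
    substitution into polynomials in one variable. *)
Theorem valid_array_count n M mu d (c : nat -> nat) :
  (\sum_(w : array n M | valid mu d w) [forall j : 'I_n, row_size w j == c j]%:R
   = \sum_(w : array n M | valid mu d w && flawless w)
       \sum_(T <- ssyt n (array_shape w))
         [forall t : 'I_n, count_mem (t : nat) (flatten T) == c t]%:R :> int)%R.
Proof.
(* [N] is the number of entries of a valid array; it bounds the row sizes and the multiplicities in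
   the tableaux, and the other sum bounds [c]. Adding 2 makes the bounds strict and keeps [B] above
   1 when both vanish. *)
pose N := \sum_(v < M) mu v; pose B := (N + \sum_(j < n) c j).+2.
have cB j : j < n -> c j < B.
  by move=> jn; rewrite /B (bigD1 (Ordinal jn)) //=; lia.
have szN (w : array n M) : valid mu d w -> \sum_(j < n) row_size w j = N.
  by move=> /asboolP [_ wmu _]; rewrite /N /row_size exchange_big /=;
    apply: eq_bigr => v _; rewrite wmu.
(* All exponents are below B, so a monomial can be read off in base B. *)
pose x j : {poly int} := ('X^(B ^ j))%R.
have xpow j a : (x j ^+ a = 'X^(a * B ^ j))%R by rewrite -exprM mulnC.
have B1 : 1 < B by [].
have two : (1 + 1 != 0 :> {poly int})%R by rewrite -polyC1 -polyCD polyC_eq0.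
have xne i k : i < k < n -> (x i != x k)%R.
  move=> /andP [ik _]; apply/eqP => /(congr1 (fun p : {poly int} => size p)).
  by rewrite !size_polyXn => -[] /eqP; rewrite eqn_exp2l // ltn_eqF.
have key (s : nat -> nat) : (forall j, j < n -> s j < B) ->
    (\sum_(j < n) c j * B ^ j == \sum_(j < n) s j * B ^ j)
    = [forall j : 'I_n, s j == c j].
  move=> sB; apply/eqP/forallP => [e j|e].
    by rewrite (digits_inj sB cB (esym e)).
  by apply: eq_bigr => j _; rewrite (eqP (e j)).
have := congr1 (fun p : {poly int} => p`_(\sum_(j < n) c j * B ^ j))%R
  (array_gf_schur M mu d two xne).
rewrite /= !coef_sum => eq_coef.
transitivity (\sum_(w : array n M | valid mu d w)
    (\prod_(j < n) x j ^+ row_size w j)`_(\sum_(j < n) c j * B ^ j)%N)%R.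
  apply: eq_bigr => w vw; under eq_bigr => j _ do rewrite xpow.
  rewrite -expr_sum coefXn key // => j jn.
  by have := szN w vw; rewrite (bigD1 (Ordinal jn)) //= /B; lia.
rewrite eq_coef; apply: eq_bigr => w /andP [vw fw].
have dw := flawless_decreasing fw; have szw : size (array_shape w) = n by rewrite size_mkseq.
rewrite /schur_poly coef_sum big_seq [RHS]big_seq; apply: eq_bigr => T TP.
have [_ bT] := (mem_ssyt T dw szw).1 TP.
rewrite /tableau_monomial -expr_sum (sum_count_flatten (fun t => B ^ t) bT) coefXn
  (key (fun t => count_mem t (flatten T))) //.
move=> t _; apply: leq_ltn_trans (count_size _ _) _.
rewrite (size_ssyt dw szw TP) /array_shape sumnE big_map -{1}[n]subn0 big_mkord szN //.
by rewrite /B; lia.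
Qed.

(** * From arrays back to sequences of integers *)

Definition cross (x y : seq int) : nat := \sum_(a <- x) count (fun b => a == b + 1)%R y.

Lemma di_cons a x : di (a :: x) = count (fun b => a == b + 1)%R x + di x.
Proof.
have diE y : di y = \sum_(i < size y) \sum_(j < size y)
    ((i < j)%N && (y`_i == y`_j + 1)%R).
  rewrite pair_bigA /= /di -sum1_card big_mkcond; apply: eq_bigr => -[i j] _ /=.
  by rewrite inE /=; case: (_ && _).
rewrite !diE /= big_ord_recl; congr (_ + _).
  rewrite big_ord_recl /= add0n -sum1_count (big_nth 0%R) big_mkord [LHS]/=.
  by rewrite [RHS]big_mkcond; apply: eq_bigr => i _; rewrite add0n; case: (_ == _).
apply: eq_bigr => i _; rewrite big_ord_recl /= add0n.
by apply: eq_bigr => j _; rewrite /bump !add1n ltnS.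
Qed.

Lemma di_cat x y : di (x ++ y) = di x + di y + cross x y.
Proof.
elim: x => [|a x IH]; first by rewrite /cross big_nil addn0 [di [::]]eq_card0 // => -[[]].
by rewrite cat_cons !di_cons IH count_cat /cross big_cons; lia.
Qed.

Lemma dual_dyck_sorted x : dual_dyck x -> sorted <%R x.
Proof. by apply: sub_sorted => a b; lia. Qed.

Lemma di_dual_dyck x : dual_dyck x -> di x = 0.
Proof.
elim: x => [|a x IH] px; first by rewrite [di [::]]eq_card0 // => -[[]].
rewrite di_cons (IH (path_sorted px)) addn0; apply/eqP; rewrite -leqn0 leqNgt -has_count.
apply/hasPn => b bx; have := dual_dyck_sorted px.
by move/(order_path_min lt_trans)/allP/(_ b bx) => /= ab; apply/eqP; lia.
Qed.

Lemma crossr_flatten x ys : cross x (flatten ys) = \sum_(y <- ys) cross x y.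
Proof.
elim: ys => [|y ys IH] /=; first by rewrite big_nil /cross big1.
rewrite big_cons -IH /cross -big_split; apply: eq_bigr => a _.
by rewrite count_cat.
Qed.

Lemma flatten_rev_mkseqS (f : nat -> seq int) n :
  flatten (rev (mkseq f n.+1)) = f n ++ flatten (rev (mkseq f n)).
Proof. by rewrite mkseqS rev_rcons. Qed.

(** A dual Dyck row increases and so contributes no pair of its own; only pairs of distinct rows
    remain, the row of larger index being read first. *)
Lemma di_flatten_rev (f : nat -> seq int) n : (forall j, dual_dyck (f j)) ->
  di (flatten (rev (mkseq f n)))
  = \sum_(l < n) \sum_(k < n) (k < l) * cross (f l) (f k).
Proof.
move=> df; elim: n => [|n IH].
  by rewrite big_ord0 di_dual_dyck.
rewrite flatten_rev_mkseqS di_cat IH di_dual_dyck // add0n big_ord_recr /=; congr (_ + _).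
  apply: eq_bigr => l _; rewrite big_ord_recr /= ltnNge ltnW //= mul0n.
  by rewrite addn0.
rewrite crossr_flatten (perm_big (mkseq f n)); last by rewrite perm_rev.
rewrite big_map big_ord_recr /= ltnn addn0 -{1}[n]subn0 big_mkord.
by apply: eq_bigr => k _; rewrite ltn_ord mul1n.
Qed.

Lemma count_flatten_rev (f : nat -> seq int) n z :
  count_mem z (flatten (rev (mkseq f n))) = \sum_(j < n) count_mem z (f j).
Proof.
elim: n => [|n IH]; first by rewrite big_ord0.
by rewrite flatten_rev_mkseqS count_cat IH big_ord_recr addnC.
Qed.

Section IntegerRows.
Variables (n M N : nat).
Implicit Types (w : array n M) (a : nat -> bool) (f : nat -> seq int).

Definition letter (v : nat) : int := (v%:Z - N%:Z)%R.

Lemma letter_inj : injective letter.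
Proof. by move=> u v; rewrite /letter; lia. Qed.

Definition row_word a : seq int := [seq letter v | v <- iota 0 M & a v].

Lemma mem_row_word a v : (letter v \in row_word a) = (v < M) && a v.
Proof. by rewrite (mem_map letter_inj) mem_filter mem_iota andbC. Qed.

Lemma row_word_sorted a : sorted <%R (row_word a).
Proof.
rewrite sorted_map; apply: sub_sorted (sorted_filter ltn_trans _ (iota_ltn_sorted 0 M)).
by move=> u v /= uv; rewrite /letter; lia.
Qed.

Lemma count_row_word a v : count_mem (letter v) (row_word a) = (v < M) && a v.
Proof.
rewrite count_uniq_mem ?mem_row_word //.
exact: sorted_uniq lt_trans ltxx _ (row_word_sorted a).
Qed.

Lemma count_row_word_sum a (p : pred int) :
  count p (row_word a) = \sum_(v < M) (a v && p (letter v)).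
Proof.
rewrite count_map count_filter -sum1_count big_mkcond -{1}[M]subn0 big_mkord.
by apply: eq_bigr => v _ /=; rewrite andbC; case: (_ && _).
Qed.

Lemma dual_dyck_row_word a : sparse a -> dual_dyck (row_word a).
Proof.
move=> sa; rewrite /dual_dyck sorted_map.
apply: (@sub_in_sorted _ a ltn); last 1 first.
- exact: sorted_filter ltn_trans _ _ (iota_ltn_sorted 0 M).
- move=> u v au av /= uv; have {}au : a u := au; have {}av : a v := av.
  have vu : v <> u.+1 by move=> e; have := sa u; rewrite au -e av.
  by rewrite /letter; lia.
- exact: filter_all.
Qed.

Lemma dual_dyck_gap x z : dual_dyck x -> z \in x -> (z + 1)%R \notin x.
Proof.
have tr : transitive (fun a b : int => a + 2 <= b)%R by move=> a b c; lia.
elim: x => //= a x IH px; have ax := order_path_min tr px.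
rewrite !inE => /orP [/eqP ->|zx]; rewrite negb_or.
  apply/andP; split; first by apply/eqP; lia.
  by apply/negP => /(allP ax); lia.
rewrite (IH (path_sorted px) zx) andbT; apply/eqP.
by have := allP ax _ zx; lia.
Qed.

Definition rows w j := row_word (entry w j).

Lemma row_size_rows w j : size (rows w j) = row_size w j.
Proof. by rewrite -count_predT count_row_word_sum; apply: eq_bigr => v _; rewrite andbT. Qed.

Lemma rows_out w j : n <= j -> rows w j = [::].
Proof.
by move=> nj; apply: size0nil; rewrite row_size_rows row_size_out.
Qed.

Lemma mem_rows w j v : (letter v \in rows w j) = entry w j v.
Proof. by rewrite mem_row_word; case: ltnP => // vM; rewrite entry_col. Qed.

Lemma dual_dyck_rows w j : reflect (sparse (entry w j)) (dual_dyck (rows w j)).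
Proof.
apply: (iffP idP) => [dw v|]; last exact: dual_dyck_row_word.
apply/negP => /andP [e1 e2]; have := @dual_dyck_gap _ (letter v) dw.
rewrite mem_rows => /(_ e1); have -> : (letter v + 1 = letter v.+1)%R by rewrite /letter; lia.
by rewrite mem_rows e2.
Qed.

Lemma cross_rows w k l :
  cross (rows w l) (rows w k) = \sum_(v < M) (entry w k v && entry w l v.+1).
Proof.
rewrite /cross big_map big_filter big_mkcond -{1}[M]subn0 big_mkord /=.
transitivity (\sum_(u < M) \sum_(v < M) (entry w l u && (entry w k v && (u == v.+1 :> nat)))).
  apply: eq_bigr => u _; rewrite count_row_word_sum.
  case: (entry w l u) => /=; last by rewrite big1.
  apply: eq_bigr => v _; congr (nat_of_bool (_ && _)).
  by rewrite /letter; apply/eqP/eqP; lia.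
rewrite exchange_big; apply: eq_bigr => v _ /=.
case: (ltnP v.+1 M) => vM.
  rewrite (bigD1 (Ordinal vM)) //= eqxx andbT andbC big1 ?addn0 // => u.
  by rewrite -val_eqE /= => /negbTE->; rewrite !andbF.
rewrite (entry_col w l vM) andbF big1 // => u _.
by rewrite ltn_eqF ?andbF // (leq_trans _ vM).
Qed.

Definition array_of f : array n M := mk_array n M (fun j v => letter v \in f j).

Lemma rows_array_of f j : j < n -> dual_dyck (f j) ->
    (forall z, z \in f j -> exists2 v, v < M & z = letter v) ->
  rows (array_of f) j = f j.
Proof.
move=> jn df inM; apply: (irr_sorted_eq lt_trans ltxx).
- exact: row_word_sorted.
- exact: dual_dyck_sorted.
move=> z; apply/idP/idP => [/mapP [v]|zf].
  by rewrite mem_filter entry_mk => /andP [/and3P [_ _ h] _] ->.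
have [v vM zE] := inM z zf.
by rewrite zE mem_rows entry_mk jn vM -zE.
Qed.

End IntegerRows.
Local Open Scope mset_scope.
Local Open Scope classical_set_scope.

Section ValidRows.
Variables (S : {mset int}) (n M N d : nat).
Hypothesis S_letters : forall z, z \in S -> exists2 v, v < M & z = letter N v.
Implicit Types w : array n M.

Definition multiplicity (v : nat) : nat := S (letter N v).

Local Notation rows := (rows N).

Lemma validP w : reflect
  [/\ forall j, dual_dyck (rows w j),
      seq_mset (flatten (rev (mkseq (rows w) n))) = S
    & di (flatten (rev (mkseq (rows w) n))) = d]
  (valid multiplicity d w).
Proof.
have di_rows : (forall j, dual_dyck (rows w j)) ->
    di (flatten (rev (mkseq (rows w) n))) = crossings w.
  move=> dw; rewrite di_flatten_rev //.
  by apply: eq_bigr => l _; apply: eq_bigr => k _; rewrite cross_rows.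
have content v : v < M -> seq_mset (flatten (rev (mkseq (rows w) n))) (letter N v)
    = \sum_(j < n) entry w j v.
  move=> vM; rewrite mset_seqE count_flatten_rev.
  by apply: eq_bigr => j _; rewrite count_row_word vM.
rewrite /valid; apply: (iffP (asboolP _)) => [[sw mw dw]|[dw mw diw]].
  have dr j : dual_dyck (rows w j) by apply/dual_dyck_rows.
  split=> //; last by rewrite di_rows.
  apply/msetP => z; case: (boolP [exists v : 'I_M, z == letter N v]) => [/existsP [v /eqP ->]|nz].
    by rewrite content // mw.
  have -> : S z = 0.
    apply/eqP; rewrite -leqn0 leqNgt -in_mset; apply: contra nz => /S_letters [v vM ->].
    by apply/existsP; exists (Ordinal vM).
  rewrite mset_seqE count_flatten_rev big1 // => j _.
  apply/count_memPn/negP => /mapP [v]; rewrite mem_filter mem_iota => /andP [_ vM] zE.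
  by move/existsP: nz; apply; exists (Ordinal vM); rewrite zE.
have Sv v : M <= v -> S (letter N v) = 0.
  move=> Mv; apply/eqP; rewrite -leqn0 leqNgt -in_mset; apply/negP => /S_letters [u uM].
  by move=> /letter_inj uv; move: uM; rewrite -uv ltnNge Mv.
split; first by move=> j; apply/dual_dyck_rows.
  move=> v; case: (ltnP v M) => vM; first by rewrite -content // mw.
  by rewrite /multiplicity Sv // big1 // => j _; rewrite entry_col.
by rewrite -di_rows.
Qed.

End ValidRows.

(** Links the two forms of the tableau condition: flaws count the entries up to a value, while
    [columns_rel] compares the entries in a column. *)
Lemma sorted_count_nth (r : seq int) (c : int) p : sorted <%R r ->
  (p < count (fun z => z <= c)%R r) = (p < size r) && (nth 0 r p <= c)%R.
Proof.
elim: r p => [|a r IH] p //= pr; have ar := order_path_min lt_trans pr.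
case: (lerP a c) => ac.
  by case: p => [|p] //=; rewrite add1n ltnS IH ?(path_sorted pr) // ltnS.
rewrite add0n (_ : count _ r = 0) ?ltn0; last first.
  apply/eqP; rewrite -leqn0 leqNgt -has_count; apply/hasPn => z zr.
  by have := allP ar _ zr; rewrite -ltNge => /= az; apply: lt_trans az.
case: p => [|p] /=; first by rewrite leNgt ac.
rewrite ltnS; case: ltnP => //= pr'; apply/esym/negbTE; rewrite -ltNge.
by apply: lt_trans ac _; apply: (allP ar); rewrite mem_nth.
Qed.

Lemma flawless_rows n M N (w : array n M) :
  flawless w <-> decreasing (array_shape w)
    /\ columns_rel 0%R (fun a b : int => a <= b + 1)%R (mkseq (rows N w) n).
Proof.
have nthr j : nth [::] (mkseq (rows N w) n) j = rows N w j.
  case: (ltnP j n) => jn; first by rewrite nth_mkseq.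
  by rewrite nth_default ?size_mkseq // rows_out.
have headE j v : head w j v.+1 = count (fun z => z <= letter N v)%R (rows N w j).
  rewrite count_row_word_sum; apply: eq_bigr => u _; rewrite andbC ltnS.
  by congr (nat_of_bool (_ && _)); rewrite /letter; lia.
have nextE v : letter N v.+1 = (letter N v + 1)%R by rewrite /letter; lia.
have szr j : size (rows N w j) = nth 0 (array_shape w) j.
  by rewrite row_size_rows nth_array_shape.
split=> [fw|[dw co]].
  split; first exact: flawless_decreasing.
  move=> j p; rewrite !nthr => pj pj1.
  have /mapP [v _ vE] := mem_nth 0%R pj1.
  have /flawlessP/(_ j v) := fw; rewrite !headE nextE => le.
  have : p < count (fun z => z <= letter N v + 1)%R (rows N w j).
    apply: leq_trans le; rewrite sorted_count_nth ?pj1 ?vE ?lexx //.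
    exact: row_word_sorted.
  by rewrite sorted_count_nth ?vE; [case/andP|apply: row_word_sorted].
apply/flawlessP => j v; rewrite !headE nextE leqNgt; apply/negP => h.
(* Row [j] has exactly [p] entries up to [letter N v + 1], whereas the column condition in column
   [p] yields one more. *)
set p := count _ (rows N w j) in h.
have : p < count (fun z => z <= letter N v)%R (rows N w j.+1) by [].
rewrite sorted_count_nth; last exact: row_word_sorted.
move=> /andP [pj1 le1].
have pj : p < size (rows N w j) by apply: leq_trans pj1 _; rewrite !szr.
suff : p < p by rewrite ltnn.
rewrite {2}/p sorted_count_nth; last exact: row_word_sorted.
rewrite pj /=; have := co j p; rewrite !nthr => /(_ pj pj1) /le_trans; apply.
by rewrite lerD2r.
Qed.

(** * Empty rows, and the coefficients of Schur functions *)

Section EmptyRows.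
Variable A : eqType.
Implicit Types T : seq (seq A).

(** Arrays have exactly [n] rows, possibly empty, while Dyck tableaux have none that is empty. When
    row lengths decrease, the empty rows are at the bottom, and [trim] and [pad] undo each other. *)
Definition trim T := filter (fun r => r != [::]) T.
Definition pad n T := T ++ nseq (n - size T) [::].

Lemma flatten_trim T : flatten (trim T) = flatten T.
Proof. by elim: T => //= -[|a r] T IH //=; rewrite IH. Qed.

Lemma flatten_pad n T : flatten (pad n T) = flatten T.
Proof.
by rewrite flatten_cat -[RHS]cats0; congr cat; elim: (n - _).
Qed.

Lemma nth_pad n T j : nth [::] (pad n T) j = nth [::] T j.
Proof.
rewrite nth_cat; case: ltnP => // jT.
by rewrite nth_nseq if_same nth_default.
Qed.

Lemma shape_pad n T : shape (pad n T) = shape T ++ nseq (n - size T) 0.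
Proof. by rewrite /pad /shape map_cat map_nseq. Qed.

Lemma size_pad n T : size T <= n -> size (pad n T) = n.
Proof. by move=> Tn; rewrite size_cat size_nseq subnKC. Qed.

Lemma mkseq_pad n T : size T <= n -> mkseq (nth [::] T) n = pad n T.
Proof.
move=> Tn; apply: (@eq_from_nth _ [::]); rewrite size_mkseq ?size_pad // => j jn.
by rewrite nth_mkseq // nth_pad.
Qed.

Lemma padK n T : [::] \notin T -> trim (pad n T) = T.
Proof.
move=> nT; rewrite /trim filter_cat [filter _ (nseq _ _)](_ : _ = [::]); last first.
  by elim: (n - _).
rewrite cats0; apply/all_filterP/allP => r rT.
by apply/negP => /eqP e; rewrite e (negbTE nT) in rT.
Qed.

Lemma trimK T : sorted geq (shape T) -> pad (size T) (trim T) = T.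
Proof.
elim: T => //= r T IH pT; have /IH IHT := path_sorted pT.
case: r pT => [|a r] /= pT; last by rewrite /pad /= subSS -/(pad _ _) IHT.
have Tnil : T = nseq (size T) [::].
  apply/all_pred1P/allP => r rT /=; rewrite -size_eq0 -leqn0.
  have := order_path_min (rev_trans leq_trans) pT.
  by move/allP/(_ (size r)); apply; apply: map_f.
have -> : trim T = [::] by rewrite Tnil; elim: (size T).
by rewrite [in RHS]Tnil.
Qed.

Lemma nth_trim T j : sorted geq (shape T) -> nth [::] (trim T) j = nth [::] T j.
Proof. by move=> sT; rewrite -{2}(trimK sT) nth_pad. Qed.

Lemma nil_notin_trim T : [::] \notin trim T.
Proof. by rewrite mem_filter eqxx. Qed.

End EmptyRows.

(** Shows that the sums over infinite families have finite support, so that the conventional value 0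
    is never taken in place of the true one. *)
Lemma fsbig_seq_widen (I : choiceType) (A : set I) (s : seq I) (F : I -> int) :
  uniq s -> (forall i, i \in s -> A i) -> (forall i, A i -> F i != 0%R -> i \in s) ->
  (\sum_(i \in A) F i = \sum_(i <- s) F i)%R.
Proof.
move=> us sA As; rewrite [RHS]fsbig_seq //; apply/esym/fsbig_widen => // i [Ai si] /=.
by apply/eqP; apply: contra_notT si => /(As _ Ai).
Qed.

Lemma sorted_decreasing (lam : seq nat) : sorted geq lam <-> decreasing lam.
Proof.
split=> [sl j|dl].
  case: (ltnP j.+1 (size lam)) => jl; last by rewrite nth_default.
  exact: (sortedP 0 sl).
by apply/(sortedP 0) => j _; apply: dl.
Qed.

Lemma columns_rel_nth (A : Type) (a0 : A) (r : rel A) T T' :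
  nth [::] T =1 nth [::] T' -> columns_rel a0 r T -> columns_rel a0 r T'.
Proof. by move=> TT' co j p; rewrite -!TT'; apply: co. Qed.

(** As [m] involves only variables below [n], so do the entries of the tableaux that contribute;
    padding their rows makes them members of [ssyt]. *)
Lemma schur_count (n : nat) (lam : seq nat) (m : {mset nat}) :
    sorted geq lam -> 0 \notin lam -> size lam <= n -> (forall r, n <= r -> m r = 0) ->
  (schur lam m = \sum_(T <- ssyt n (lam ++ nseq (n - size lam) 0))
     [forall t : 'I_n, count_mem (t : nat) (flatten T) == m t]%:R)%R.
Proof.
move=> sl nl szl mn; set lam' := lam ++ _.
have szl' : size lam' = n by rewrite size_cat size_nseq subnKC.
have nthl' j : nth 0 lam' j = nth 0 lam j.
  by rewrite nth_cat nth_nseq if_same; case: ltnP => // h; rewrite nth_default.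
have dl' : decreasing lam' by move=> j; rewrite !nthl'; exact: ((sorted_decreasing lam).1 sl).
have sl' := (sorted_decreasing lam').2 dl'.
have shT T : T \in ssyt n lam' -> sorted geq (shape T) /\ size T = n.
  by move=> /(mem_ssyt T dl' szl') [[sh _ _] _]; rewrite -(size_map size) -/(shape T) sh.
rewrite /schur /fps_sum (@fsbig_seq_widen _ _ (map (@trim nat) (ssyt n lam'))).
- rewrite big_map big_seq [RHS]big_seq; apply: eq_bigr => T TP.
  have [_ bT] := (mem_ssyt T dl' szl').1 TP.
  rewrite /fps_monomial flatten_trim; congr ((nat_of_bool _)%:R)%R.
  apply/eqP/forallP => [-> t|e]; first by rewrite mset_seqE.
  apply/msetP => t; rewrite mset_seqE; case: (ltnP t n) => tn.
    by rewrite -(eqP (e (Ordinal tn))).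
  rewrite mn //; apply/esym/count_memPn/negP => /flattenP [r /(nthP [::]) [j _ <-]].
  by move/(allP (bT j)); rewrite ltnNge tn.
- rewrite map_inj_in_uniq ?ssyt_uniq // => T T' /shT [sT zT] /shT [sT' zT'] e.
  by rewrite -(trimK sT) -(trimK sT') zT zT' e.
- move=> _ /mapP [T TP ->]; have [sT zT] := shT _ TP.
  have [[sh so co] _] := (mem_ssyt T dl' szl').1 TP.
  split; last by apply: columns_rel_nth co => j; rewrite nth_trim.
    have -> : shape (trim T) = filter (fun k => k != 0) (shape T).
      by rewrite /shape filter_map; congr map; apply: eq_filter => r /=; rewrite size_eq0.
    rewrite sh filter_cat [filter _ (nseq _ _)](_ : _ = [::]); last by elim: (n - _).
    by rewrite cats0; apply/all_filterP/allP => k kl; apply: contraNneq nl => <-.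
  by apply/allP => r; rewrite mem_filter => /andP [_ /(allP so)].
move=> T [sh so co]; rewrite /fps_monomial; case: (m =P _) => [mE _|_]; last by rewrite eqxx.
have zT : size T <= n by rewrite -(size_map size) -/(shape T) sh.
apply/mapP; exists (pad n T); last first.
  rewrite padK //; apply: contra nl => nT; rewrite -sh; exact: (map_f size nT).
apply/(mem_ssyt _ dl' szl'); split; last first.
  move=> j; apply/allP => t; rewrite nth_pad => tT; rewrite ltnNge; apply/negP => /mn.
  rewrite mE mset_seqE => /count_memPn /negP; apply; apply/flattenP.
  exists (nth [::] T j) => //; apply: mem_nth; rewrite ltnNge; apply/negP => jT.
  by rewrite nth_default in tT.
split.
- by rewrite shape_pad sh -(size_map size T) -/(shape T) sh.
- by rewrite all_cat so all_nseq orbT.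
- by apply: columns_rel_nth co => j; rewrite nth_pad.
Qed.

(** * Counting factorizations and tableaux by arrays *)

Lemma seq_mset_letters (S : {mset int}) :
  exists M N, forall z, z \in S -> exists2 v, v < M & z = letter N v.
Proof.
pose b := \max_(z <- finsupp S) `|z|%N.
exists (b + b).+1, b => z zS; have zb : `|z|%N <= b.
  by apply: (@leq_bigmax_seq _ _ xpredT absz); rewrite // -msuppE in zS *.
by exists (absz (z + b%:Z)%R); rewrite /letter; lia.
Qed.

Lemma flatten_rev_trim (A : eqType) (T : seq (seq A)) :
  flatten (rev (trim T)) = flatten (rev T).
Proof. by rewrite -[RHS]flatten_trim /trim filter_rev. Qed.

Section Counting.
Variables (S : {mset int}) (n M N d : nat) (m : {mset nat}).
Hypothesis S_letters : forall z, z \in S -> exists2 v, v < M & z = letter N v.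
Hypothesis m_small : forall r, n <= r -> m r = 0.
Implicit Types w : array n M.

Local Notation rows := (rows N).
Local Notation mu := (multiplicity S N).

Lemma fconcat_mkseq (F : factors) : (forall r, n <= r -> F r = [::]) ->
  fconcat F = flatten (mkseq F n).
Proof.
move=> Fn; rewrite /fconcat; set k := (\max_(r <- _) _).
have Fk r : k <= r -> F r = [::].
  move=> kr; apply/fsfun_dflt/negP => rF; move: kr.
  by rewrite leqNgt; apply/negP/negPn; apply: (@leq_bigmax_seq _ _ xpredT succn).
suff out i j : (forall r, i <= r -> F r = [::]) ->
    flatten (mkseq F i) = flatten (mkseq F (i + j)).
  by case: (leqP k n) => h; [rewrite -(subnKC h)|rewrite -(subnKC (ltnW h))];
    rewrite -out.
move=> Fi; elim: j => [|j IH]; first by rewrite addn0.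
by rewrite addnS mkseqS -cats1 flatten_cat -IH /= Fi ?leq_addr // !cats0.
Qed.

(** The order is reversed so that the concatenation of the factors is the word reading the last row
    first, for which [valid] fixes [di]. *)
Definition factors_of_array w : factors :=
  [fsfun r in [fset r in iota 0 n]%fset => rows w (n.-1 - r)].

Lemma factors_of_arrayE w r : factors_of_array w r = if r < n then rows w (n.-1 - r) else [::].
Proof. by rewrite fsfunE in_fset -[in_mem _ _]/(r \in iota 0 n) mem_iota. Qed.

Lemma fconcat_rev (F : factors) (f : nat -> seq int) : (forall r, n <= r -> F r = [::]) ->
  (forall j, j < n -> f j = F (n.-1 - j)) -> fconcat F = flatten (rev (mkseq f n)).
Proof.
move=> Fn fF; rewrite (fconcat_mkseq Fn); congr flatten.
apply: (@eq_from_nth _ [::]); rewrite ?size_rev !size_mkseq // => r rn.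
rewrite nth_rev ?size_mkseq // !nth_mkseq ?fF //; try lia.
by congr (F _); lia.
Qed.

Lemma factors_weightE (F : factors) r : factors_weight F r = size (F r).
Proof.
rewrite fsfunE; case: ifPn => // rF.
by rewrite (fsfun_dflt rF).
Qed.

Lemma rows_inj w w' : (forall j, j < n -> rows w j = rows w' j) -> w = w'.
Proof. by move=> e; apply: arrayP => j v jn vM; rewrite -!(mem_rows N) e. Qed.

Lemma DS_count :
  (DS S d m = \sum_(w : array n M | valid mu d w)
     [forall j : 'I_n, row_size w j == m j]%:R)%R.
Proof.
(* The reversal of the rows also reverses the exponents of the weight; the symmetry of the row sizes
   repairs this. *)
transitivity (\sum_(w : array n M | valid mu d w)
     [forall j : 'I_n, row_size w (n.-1 - j) == m j]%:R : int)%R; last first.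
  pose G (c : {ffun 'I_n -> nat}) : int := ([forall j, c j == m j]%:R)%R.
  rewrite [RHS](eq_bigr (fun w => G (sizes w))); last first.
    by move=> w _; congr ((nat_of_bool _)%:R)%R; apply: eq_forallb => j; rewrite ffunE.
  rewrite (sum_sizes_perm M mu d G (perm (@rev_ord_inj n))); apply: eq_bigr => w _.
  congr ((nat_of_bool _)%:R)%R; apply: eq_forallb => j; rewrite !ffunE permE /=.
  by congr (row_size w _ == _); lia.
have out w r : n <= r -> factors_of_array w r = [::].
  by move=> nr; rewrite factors_of_arrayE ltnNge nr.
have rowsE w j : j < n -> rows w j = factors_of_array w (n.-1 - j).
  by move=> jn; rewrite factors_of_arrayE ifT; [congr (rows w _)|]; lia.
rewrite /DS /fps_sum (@fsbig_seq_widen _ _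
  (map factors_of_array (enum [pred w : array n M | valid mu d w]))).
- rewrite big_map big_enum; apply: eq_bigr => w _; rewrite /fps_monomial.
  congr ((nat_of_bool _)%:R)%R; apply/eqP/forallP => [-> j|e].
    by rewrite factors_weightE factors_of_arrayE ltn_ord row_size_rows.
  apply/msetP => r; rewrite factors_weightE; case: (ltnP r n) => rn.
    by rewrite factors_of_arrayE rn row_size_rows -(eqP (e (Ordinal rn))).
  by rewrite out // m_small.
- rewrite map_inj_uniq ?enum_uniq // => w w' e; apply: rows_inj => j jn.
  by rewrite !rowsE // e.
- move=> _ /mapP [w + ->]; rewrite mem_enum inE => /(@validP _ _ _ _ _ S_letters) [dw mw diw].
  rewrite /= /dual_dyck_factorization (fconcat_rev (out w) (rowsE w)); split=> //; split=> // r.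
  rewrite factors_of_arrayE; case: ifP => //.
move=> F [[mF dF] diF]; rewrite /fps_monomial.
case: (m =P _) => [mE _|_]; last by rewrite eqxx.
have outF r : n <= r -> F r = [::].
  by move=> /m_small; rewrite mE factors_weightE => /size0nil.
pose f j := if j < n then F (n.-1 - j) else [::].
have fE j : j < n -> f j = F (n.-1 - j) by rewrite /f => ->.
have FE := fconcat_rev outF fE.
have rE j : rows (array_of n M N f) j = f j.
  case: (ltnP j n) => jn; last by rewrite rows_out // /f ltnNge jn.
  apply: rows_array_of => //; first by rewrite fE.
  move=> z zf; apply: S_letters; rewrite -mF FE in_mset mset_seqE -has_count has_pred1.
  apply/flattenP; exists (f j) => //.
  by rewrite mem_rev; apply: map_f; rewrite mem_iota.
have rE' : mkseq (rows (array_of n M N f)) n = mkseq f n.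
  by apply: eq_mkseq => j; rewrite rE.
apply/mapP; exists (array_of n M N f).
  rewrite mem_enum inE; apply/(@validP _ _ _ _ _ S_letters); rewrite rE' -FE; split=> // j.
  by rewrite rE /f; case: ifP.
apply/fsfunP => r; rewrite factors_of_arrayE rE; case: ltnP => rn; last exact: outF.
by rewrite fE; [congr (F _)|]; lia.
Qed.

Hypothesis S_small : size S <= n.

Definition tableau_of_array w := trim (mkseq (rows w) n).

Lemma tableau_of_array_props w : valid mu d w -> flawless w ->
  [/\ sorted geq (shape (mkseq (rows w) n)), pad n (tableau_of_array w) = mkseq (rows w) n,
      shape (mkseq (rows w) n) = array_shape w
    & [/\ dyck_tableau (tableau_of_array w), seq_mset (flatten (tableau_of_array w)) = S
        & di (row_reading (tableau_of_array w)) = d]].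
Proof.
move=> /(@validP _ _ _ _ _ S_letters) [dw mw diw] /(flawless_rows N) [decw co].
have shE : shape (mkseq (rows w) n) = array_shape w.
  by rewrite /shape -map_comp; apply: eq_map => j; rewrite /= row_size_rows.
have sg : sorted geq (shape (mkseq (rows w) n)) by rewrite shE; apply/sorted_decreasing.
have padE : pad n (tableau_of_array w) = mkseq (rows w) n.
  by rewrite -[X in pad X](size_mkseq (rows w) n) trimK.
split=> //; split; last by rewrite /row_reading flatten_rev_trim.
  split; first exact: nil_notin_trim.
  - rewrite (_ : shape _ = filter (fun k => k != 0) (shape (mkseq (rows w) n))).
      by apply: sorted_filter sg; apply: (rev_trans leq_trans).
    by rewrite /shape filter_map; congr map; apply: eq_filter => r /=; rewrite size_eq0.
  - by apply/allP => r; rewrite mem_filter => /andP [_ /mapP [j _ ->]].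
  - by apply: columns_rel_nth co => j; rewrite nth_trim.
rewrite flatten_trim -mw; apply/eq_seq_msetP/perm_flatten.
by rewrite perm_sym perm_rev.
Qed.

Lemma dyck_tableau_sum_count :
  (fps_sum [set P | [/\ dyck_tableau P, seq_mset (flatten P) = S & di (row_reading P) = d]]
     (fun P => schur (shape P)) m
   = \sum_(w : array n M | valid mu d w && flawless w)
       \sum_(T <- ssyt n (array_shape w))
         [forall t : 'I_n, count_mem (t : nat) (flatten T) == m t]%:R)%R.
Proof.
rewrite /fps_sum (@fsbig_seq_widen _ _
  (map tableau_of_array (enum [pred w : array n M | valid mu d w && flawless w]))).
- rewrite big_map big_enum; apply: eq_bigr => w /andP [vw fw].
  have [sg padE shE [[nil so _ _] _ _]] := tableau_of_array_props vw fw.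
  have sz : size (tableau_of_array w) <= n.
    by rewrite -[X in _ <= X](size_mkseq (rows w) n) size_filter count_size.
  rewrite (schur_count so _ _ m_small) ?size_map -?shE //; last first.
    by apply: contra nil => /mapP [r rT /esym /size0nil <-].
  by rewrite -padE shape_pad.
- rewrite map_inj_in_uniq ?enum_uniq // => w w'; rewrite !mem_enum !inE.
  move=> /andP [vw fw] /andP [vw' fw'] e; apply: rows_inj => j jn.
  have [_ padE _ _] := tableau_of_array_props vw fw.
  have [_ padE' _ _] := tableau_of_array_props vw' fw'.
  have : mkseq (rows w) n = mkseq (rows w') n by rewrite -padE -padE' e.
  by move/(congr1 (fun T => nth [::] T j)); rewrite !nth_mkseq.
- move=> _ /mapP [w + ->]; rewrite mem_enum inE => /andP [vw fw].
  by have [] := tableau_of_array_props vw fw.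
move=> P [[nil so dP co] mP diP] _.
(* Rows are nonempty, so there are at most as many of them as entries in [S]. *)
have szP : size P <= n.
  apply: leq_trans S_small; rewrite (perm_size (s2 := flatten P)); last first.
    by apply/eq_seq_msetP; rewrite seq_mset_id mP.
  elim: (P) nil => //= -[|a r] Q IH //=; rewrite inE /= => /IH QE.
  by rewrite size_cat; lia.
pose f j := nth [::] P j.
have rE j : rows (array_of n M N f) j = f j.
  case: (ltnP j n) => jn; last by rewrite rows_out // /f nth_default // (leq_trans szP).
  case: (ltnP j (size P)) => jP; last first.
    by apply: rows_array_of => //; rewrite /f nth_default.
  apply: rows_array_of => //; first by apply: (allP dP); apply: mem_nth.
  move=> z zf; apply: S_letters; rewrite -mP in_mset mset_seqE -has_count has_pred1.
  by apply/flattenP; exists (f j) => //; apply: mem_nth.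
have rE' : mkseq (rows (array_of n M N f)) n = pad n P.
  by rewrite -mkseq_pad //; apply: eq_mkseq => j; rewrite rE.
have sg : sorted geq (shape (pad n P)).
  apply/sorted_decreasing => j; rewrite shape_pad !nth_cat !nth_nseq !if_same !size_map.
  have /sorted_decreasing/(_ j) := so.
  case: ltnP => jP; last by []. 
  by rewrite ifT // ltnW.
apply/mapP; exists (array_of n M N f); last by rewrite /tableau_of_array rE' padK.
rewrite mem_enum inE; apply/andP; split.
  apply/(@validP _ _ _ _ _ S_letters); rewrite rE'; split.
  - by move=> j; rewrite rE /f; case: (ltnP j (size P)) => jP;
      [apply: (allP dP); apply: mem_nth|rewrite nth_default].
  - rewrite -mP; apply/eq_seq_msetP; rewrite -[flatten P](flatten_pad n).
    by apply: perm_flatten; rewrite perm_rev.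
  - by rewrite -diP /row_reading -[in RHS](padK n nil) flatten_rev_trim.
apply/(flawless_rows N); rewrite rE'; split; last first.
  by apply: columns_rel_nth co => j; rewrite nth_pad.
move/sorted_decreasing : sg; rewrite -rE'.
rewrite (_ : shape _ = array_shape (array_of n M N f)) //.
by rewrite /shape -map_comp; apply: eq_map => j; rewrite /= row_size_rows.
Qed.

End Counting.

Theorem corollary3p19 (S : {mset int}) (d : nat) :
  DS S d =
  fps_sum
    [set P | [/\ dyck_tableau P, seq_mset (flatten P) = S
               & di (row_reading P) = d]]
    (fun P => schur (shape P)).
Proof.
apply/funext => m.
have [M [N S_letters]] := seq_mset_letters S.
(* Large enough at once for the rows of any tableau with entries [S] and for the variables in
   [m]. *)
pose n := size S + \max_(r <- finsupp m) r.+1.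
have S_small : size S <= n by apply: leq_addr.
have m_small r : n <= r -> m r = 0.
  move=> nr; apply/fsfun_dflt/negP => rm.
  have := @leq_bigmax_seq _ _ xpredT succn r rm isT.
  by rewrite ltnNge (leq_trans (leq_addl _ _) nr).
rewrite (DS_count d S_letters m_small) (dyck_tableau_sum_count d S_letters m_small S_small).
exact: valid_array_count.
Qed.
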